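(* Let $n\ge2$. The Lie algebras (inside $\mathrm{C}$, with bracket $[U,V]=UV-VU$) of the Lie groups $\mathrm{P},\mathrm{A},\mathrm{B},\mathrm{Q},\mathrm{Q}'$ are as follows. <ul> <li>$\mathfrak p=\mathrm{C}^{(0)}\oplus\mathrm{C}^n$ if $n$ is odd, and $\mathfrak p=\mathrm{C}^{(0)}$ if $n$ is even.</li> <li>$\mathfrak a=\mathrm{C}^0\oplus\mathrm{C}^{\overline2}\oplus\mathrm{C}^{\overline3}\oplus\mathrm{C}^n$ if $n\equiv1\pmod4$, and $\mathfrak a=\mathrm{C}^0\oplus\mathrm{C}^{\overline2}\oplus\mathrm{C}^{\overline3}$ otherwise.</li> <li>$\mathfrak b=\mathrm{C}^0\oplus\mathrm{C}^{\overline1}\oplus\mathrm{C}^{\overline2}\oplus\mathrm{C}^n$ if $n\equiv3\pmod4$, and $\mathfrak b=\mathrm{C}^0\oplus\mathrm{C}^{\overline1}\oplus\mathrm{C}^{\overline2}$ otherwise.</li> <li>$\mathfrak q=\mathrm{C}^0\oplus\mathrm{C}^{\overline2}\oplus\mathrm{C}^n$ if $n$ is odd, and $\mathfrak q=\mathrm{C}^0\oplus\mathrm{C}^{\overline2}$ if $n$ is even.</li> <li>$\mathfrak q'=\mathrm{C}^0\oplus\mathrm{C}^{\overline2}\oplus\mathrm{C}^n$ if $n\equiv0\pmod4$, and $\mathfrak q'=\mathfrak q$ otherwise.</li> </ul> Their dimensions are $\dim\mathfrak p=2^{n-1}+[n \text{ odd}]$, $\dim\mathfrak a=2^{n-1}-2^{\frac{n-1}{2}}\sin\frac{\pi(n+1)}4+1+[n\equiv1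 \bmod 4]$, $\dim\mathfrak b=2^{n-1}-2^{\frac{n-1}{2}}\cos\frac{\pi(n+1)}4+1+[n\equiv3\bmod 4]$, and $\dim\mathfrak q=2^{n-2}-2^{\frac{n-2}{2}}\cos\frac{\pi n}4+1+[n\text{ odd}]$; for $n\equiv0\pmod4$, $\dim\mathfrak q'=\dim\mathfrak q+1$. Here $[\cdot]$ is $1$ if the condition holds and $0$ otherwise. Moreover: <ul> <li>$\gamma\subseteq\mathfrak q\subseteq\mathfrak p$, $\mathfrak q\subseteq\mathfrak a$, $\mathfrak q\subseteq\mathfrak b$, and $\mathfrak q=\mathfrak a\cap\mathfrak p=\mathfrak b\cap\mathfrak p=\mathfrak a\cap\mathfrak b$.</li> <li>$\mathfrak q=\mathfrak p=\mathfrak a$ for $n\le3$.</li> <li>For $n=4$, the three algebras $\mathfrak q,\mathfrak p,\mathfrak a$ are pairwise distinct.</li> <li>$\gamma=\mathfrak q$ for $n\le5$, and $\gamma\ne\mathfrak q$ for $n=6$.</li> <li>For $n\equiv0\pmod4$: $\mathfrak q\subseteq\mathfrak q'\subseteq\mathfrak p$, $\gamma\subseteq\mathfrak q'$, and $\mathfrak q\ne\mathfrak q'$; furthermore $\mathfrak q'=\mathfrak p$ for $n=4$, and $\mathfrak q'\ne\mathfrak p$ for $n\ge8$.</li> </ul>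
   Context: Let $\mathrm{C}$ be either the real Clifford algebra $C\ell_{p,q}$ with $p+q=n$, or the complex Clifford algebra $C\ell(\mathbb{C}^n)$. It has identity $e$ and generators $e_1,\dots,e_n$ satisfying $e_ae_b+e_be_a=2\eta_{ab}e$. In the real case $\eta=\mathrm{diag}(1,\dots,1,-1,\dots,-1)$ with $p$ entries $+1$ and $q$ entries $-1$. In the complex case $\eta=I_n$. $\mathrm{C}^k$ is the grade-$k$ subspace, spanned by the products $e_{a_1}\cdots e_{a_k}$ with $a_1<\dots<a_k$. The even subspace is $\mathrm{C}^{(0)}=\bigoplus_{k\text{ even}}\mathrm{C}^k$ and the odd subspace is $\mathrm{C}^{(1)}=\bigoplus_{k\text{ odd}}\mathrm{C}^k$. For $m=0,1,2,3$ let $\mathrm{C}^{\overline m}=\bigoplus_{k\equiv m\pmod4}\mathrm{C}^k$. The grade involution $U\mapsto\hat U$ is the linear automorphism acting on $\mathrm{C}^k$ as $(-1)^k$. The reversion $U\mapsto\tilde U$ is the linear anti-automorphism acting on $\mathrm{C}^k$ as $(-1)^{k(k-1)/2}$. For $S\subseteq\mathrm{C}$, $S^\times$ is the set of elements of $S$ invertible in $\mathrm{C}$, and $\mathrm{C}^{\times(j)}:=(\mathrm{C}^{(j)})^\times$. $\mathrm{Z}$ is the center: $\mathrm{Z}=\mathrm{C}^0$ for $n$ even and $\mathrm{Z}=\mathrm{C}^0\oplus\mathrm{C}^n$ for $n$ odd. Define the following closed subgroups of $\mathrm{C}^\times$: <ul> <li>$\mathrm{P}:=\mathrm{Z}^\times(\mathrm{C}^{\times(0)}\cup\mathrm{C}^{\times(1)})=\{WT: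 W\in\mathrm{Z}^\times, T\in\mathrm{C}^{\times(0)}\cup\mathrm{C}^{\times(1)}\}$;</li> <li>$\mathrm{A}:=\{T\in\mathrm{C}^\times:\tilde TT\in\mathrm{Z}^\times\}$;</li> <li>$\mathrm{B}:=\{T\in\mathrm{C}^\times:\hat{\tilde T}T\in\mathrm{Z}^\times\}$;</li> <li>$\mathrm{Q}:=\{T\in\mathrm{P}:\tilde TT\in\mathrm{Z}^\times\}$;</li> <li>$\mathrm{Q}':=\{T\in\mathrm{P}:\tilde TT\in(\mathrm{C}^0\oplus\mathrm{C}^n)^\times\}$;</li> <li>the Clifford group $\Gamma=\{T\in\mathrm{C}^\times: T\,\mathrm{C}^1\,T^{-1}\subseteq\mathrm{C}^1\}$.</li> </ul> The Lie algebra of a closed subgroup $G\subseteq\mathrm{C}^\times$ is $\{U\in\mathrm{C}: \exp(tU)\in G\ \text{for all}\ t\in\mathbb{R}\}$. The Lie algebras of $\mathrm{P},\mathrm{A},\mathrm{B},\mathrm{Q},\mathrm{Q}'$ are denoted $\mathfrak p,\mathfrak a,\mathfrak b,\mathfrak q,\mathfrak q'$. The Lie algebra of $\Gamma$ is $\gamma$, which equals $\mathrm{C}^0\oplus\mathrm{C}^2$ for $n$ even and $\mathrm{C}^0\oplus\mathrm{C}^2\oplus\mathrm{C}^n$ for $n$ odd. Dimensions are over the ground field ($\mathbb{R}$ or $\mathbb{C}$). *)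

(* Defs.v *)
From HB Require Import structures.
From mathcomp Require Import all_boot all_order all_algebra.
From mathcomp Require Import all_classical all_reals all_analysis.
From mathcomp Require Import complex.
Set Implicit Arguments. Unset Strict Implicit. Unset Printing Implicit Defensive.
Import Order.TTheory GRing.Theory Num.Theory.
Local Open Scope ring_scope.
Local Open Scope classical_set_scope.

(* Clifford algebra over a field K, generated by e_0,...,e_{n-1} with
   e_a e_b + e_b e_a = 2 eta_a delta_{ab}.  An element is represented by its
   coordinates in the blade basis e_A = e_{a_1}...e_{a_k} (a_1<...<a_k),
   indexed by A : {set 'I_n}. *)
Section Clifford.
Variables (K : numFieldType) (n : nat) (eta : 'I_n -> K).

Definition cl := {ffun {set 'I_n} -> K^o}.

(* sign/scalar in e_A e_B = csign A B e_{A Δ B} *)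
Definition csign (A B : {set 'I_n}) : K :=
  (-1) ^+ #|[set x : 'I_n * 'I_n | (x.1 \in A) && (x.2 \in B) && (x.2 < x.1)%N]|
  * \prod_(i in A :&: B) eta i.

Definition cmul (U V : cl) : cl :=
  [ffun C => \sum_(A : {set 'I_n}) \sum_(B : {set 'I_n})
     (if C == (A :\: B) :|: (B :\: A) then csign A B * U A * V B else 0)].

Definition blade (A : {set 'I_n}) : cl := [ffun C => (C == A)%:R].
Definition cone : cl := blade (@finset.set0 _).


Definition cpow (U : cl) (k : nat) : cl := iter k (cmul U) cone.

Definition cexp (U : cl) : cl :=
  [ffun C => limn (fun m => \sum_(k < m) ((cpow U k C) / (k`!)%:R : K^o))].

Definition ghat (U : cl) : cl := [ffun A : {set 'I_n} => (-1) ^+ #|A| * U A].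
Definition crev (U : cl) : cl :=
  [ffun A : {set 'I_n} => (-1) ^+ ((#|A| * (#|A| - 1)) %/ 2) * U A].

(* the direct sum of the grade-k subspaces C^k over the grades k with P k *)
Definition grades (P : nat -> bool) : set cl :=
  [set U | forall A : {set 'I_n}, U A != 0 -> P #|A|].

Definition inv_pair (T S : cl) := cmul T S = cone /\ cmul S T = cone.
Definition units_of (S : set cl) : set cl :=
  [set T | S T /\ exists S', inv_pair T S'].
Definition cunits : set cl := units_of setT.

Definition center : set cl := grades (fun k => (k == 0%N) || (odd n && (k == n))).

Definition groupP : set cl :=
  [set T | exists W T', units_of center W /\
      (units_of (grades (fun k => ~~ odd k)) T' \/ units_of (grades odd) T') /\
      T = cmul W T'].
Definition groupA : set cl := [set T | cunits T /\ units_of center (cmul (crev T) T)].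
Definition groupB : set cl :=
  [set T | cunits T /\ units_of center (cmul (ghat (crev T)) T)].
Definition groupQ : set cl := [set T | groupP T /\ units_of center (cmul (crev T) T)].
Definition groupQ' : set cl :=
  [set T | groupP T /\
     units_of (grades (fun k => (k == 0%N) || (k == n))) (cmul (crev T) T)].
Definition clifford_group : set cl :=
  [set T | exists Ti, inv_pair T Ti /\
     forall X, grades (eq_op 1%N) X -> grades (eq_op 1%N) (cmul (cmul T X) Ti)].

Definition liealg (R : realType) (emb : R -> K) (G : set cl) : set cl :=
  [set U | forall t : R, G (cexp (emb t *: U))].

End Clifford.

Definition lie_claims (R : realType) (K : numFieldType) (n : nat)
    (eta : 'I_n -> K) (emb : R -> K) : Prop :=
  let L := @liealg K n eta R emb in
  let gr := @grades K n in
  let p := L (groupP eta) in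
  let a := L (groupA eta) in
  let b := L (groupB eta) in
  let q := L (groupQ eta) in
  let q' := L (groupQ' eta) in
  let g := L (clifford_group eta) in
  let nR : R := n%:R in
  [/\ p = gr (fun k => ~~ odd k || (odd n && (k == n))),
      a = gr (fun k => [|| k == 0%N, k %% 4 == 2, k %% 4 == 3
                          | (n %% 4 == 1) && (k == n)]%N),
      b = gr (fun k => [|| k == 0%N, k %% 4 == 1, k %% 4 == 2
                          | (n %% 4 == 3) && (k == n)]%N),
      q = gr (fun k => [|| k == 0%N, k %% 4 == 2 | odd n && (k == n)]%N) &
      q' = (if (n %% 4 == 0)%N
            then gr (fun k => [|| k == 0%N, k %% 4 == 2 | k == n]%N) else q)]
  /\ [/\ (exists V : {vspace cl K n}, [set U | U \in V] = p /\
            \dim V = (2 ^ n.-1 + odd n)%N),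
      (exists V : {vspace cl K n}, [set U | U \in V] = a /\
            (\dim V)%:R = (2 ^ n.-1)%:R
               - 2 `^ ((nR - 1) / 2) * sin (pi * (nR + 1) / 4) + 1
               + (n %% 4 == 1)%N%:R :> R),
      (exists V : {vspace cl K n}, [set U | U \in V] = b /\
            (\dim V)%:R = (2 ^ n.-1)%:R
               - 2 `^ ((nR - 1) / 2) * cos (pi * (nR + 1) / 4) + 1
               + (n %% 4 == 3)%N%:R :> R),
      (exists V : {vspace cl K n}, [set U | U \in V] = q /\
            (\dim V)%:R = (2 ^ n.-2)%:R
               - 2 `^ ((nR - 2) / 2) * cos (pi * nR / 4) + 1
               + (odd n)%:R :> R) &
      ((n %% 4 == 0)%N -> exists V V' : {vspace cl K n},
            [set U | U \in V] = q /\ [set U | U \in V'] = q' /\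
            \dim V' = (\dim V).+1)]
  /\ [/\ g `<=` q /\ q `<=` p /\ q `<=` a /\ q `<=` b /\
         q = a `&` p /\ q = b `&` p /\ q = a `&` b,
      (n <= 3)%N -> q = p /\ p = a,
      n = 4%N -> q <> p /\ p <> a /\ q <> a,
      ((n <= 5)%N -> g = q) /\ (n = 6%N -> g <> q) &
      ((n %% 4 == 0)%N ->
         q `<=` q' /\ q' `<=` p /\ g `<=` q' /\ q <> q' /\
         (n = 4%N -> q' = p) /\ ((8 <= n)%N -> q' <> p))].

(* Main.v *)
Require Import Defs.
From mathcomp Require Import all_boot all_order all_algebra.
From mathcomp Require Import all_classical all_reals all_analysis.
From mathcomp Require Import complex.
From mathcomp Require Import zify ring lra.
Set Implicit Arguments. Unset Strict Implicit. Unset Printing Implicit Defensive.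
Import Order.TTheory GRing.Theory Num.Theory.
Import numFieldNormedType.Exports.
Local Open Scope ring_scope.

(* For elements U, V, X of a Clifford algebra, left multiplication by U and right
   multiplication by V commute, so exp(U) X exp(V) is the sum of D^k X / k! with
   D Y = U Y + Y V.  Hence a sum S of grade subspaces that contains X and is stable
   under D contains exp(U) X exp(V); conversely, if exp(tU) X exp(tV) lies in S for
   all t, then so does the first-order term U X + X V.  The Lie algebras follow by
   applying this to hat(T) T^-1 (which is central for T in P), to rev(T) T, to
   hat(rev(T)) T, and to T v T^-1 for vectors v, where T = exp(tU): the conditions
   become that hat U - U, rev U + U, hat(rev U) + U are central and that [U, v] is a
   vector, and they can be read off in the basis of blades.  The dimensions are sums
   of binomial coefficients over residue classes modulo 4, read off from (1 + i)^n. *)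

(** The exponential is a coordinatewise limit over an abstract [numFieldType], so the formula for
    exp(U) X exp(V) is the analytic core. The l1 norm in blade coordinates is submultiplicative
    because every structure constant [csign A B] has absolute value 1, and it dominates the double
    series by real exponentials. The few analytic facts needed about the scalars are collected in
    [exp_scalars], so that the real and the complex case share one proof. No derivative is taken:
    grade subspaces are given by vanishing coordinates, so invariance passes to limits, and the
    first-order term is isolated by an O(t^2) estimate. The algebra rests on two parities: e_A and
    e_B commute exactly when |A||B| + |A :&: B| is even, and the reversion sign of grade k is that
    of C(k, 2). For Q' with n even, C^n is not central, so stability under D uses instead that C^n
    commutes with even elements. *)

Lemma odd_bin2_shift d c : odd 'C(d + c.*2, 2) = odd 'C(d, 2) (+) odd c.
Proof.
elim: c => [|c IH]; first by rewrite addn0 addbF.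
rewrite doubleS !addnS !(binS _ 1) !bin1 !oddD IH /= oddD odd_double addbF.
by case: (odd d); case: (odd _); case: (odd c).
Qed.

Lemma bin2_add a b : ('C(a + b, 2) = 'C(a, 2) + 'C(b, 2) + a * b)%N.
Proof.
elim: b => [|b IH]; first by rewrite addn0 muln0 !addn0.
by rewrite addnS !(binS _ 1) !bin1 IH mulnS; lia.
Qed.

(** This turns conditions on the reversion sign into residue classes modulo 4. *)
Lemma odd_bin2_mod4 k : odd 'C(k, 2) = (2 <= k %% 4)%N.
Proof.
rewrite {1}(divn_eq k 4) addnC.
have -> : (k %/ 4 * 4 = (k %/ 4).*2.*2)%N by lia.
rewrite odd_bin2_shift odd_double addbF.
by have := ltn_pmod k (isT : (0 < 4)%N); case: (k %% 4)%N => [|[|[|[|]]]].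
Qed.

(** * Symmetric differences, the index sets of blade products *)

Section SymmetricDifference.
Variable n : nat.
Implicit Types A B C : {set 'I_n}.

Definition symd A B := (A :\: B) :|: (B :\: A).

Lemma in_symd A B i : (i \in symd A B) = (i \in A) (+) (i \in B).
Proof. by rewrite !inE; case: (i \in A); case: (i \in B). Qed.

Lemma symdA A B C : symd A (symd B C) = symd (symd A B) C.
Proof. by apply/setP => i; rewrite !in_symd addbA. Qed.

Lemma symdC A B : symd A B = symd B A.
Proof. by apply/setP => i; rewrite !in_symd addbC. Qed.

Lemma symd0 A : symd A finset.set0 = A.
Proof. by apply/setP => i; rewrite in_symd inE addbF. Qed.

Lemma symd0l A : symd finset.set0 A = A.
Proof. by rewrite symdC symd0. Qed.

Lemma symdv A : symd A A = finset.set0.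
Proof. by apply/setP => i; rewrite in_symd inE addbb. Qed.

Lemma symdK A B : symd A (symd A B) = B.
Proof. by rewrite symdA symdv symdC symd0. Qed.

Lemma card_symd A B : (#|symd A B| + #|A :&: B|.*2 = #|A| + #|B|)%N.
Proof.
have := cardsU (A :\: B) (B :\: A).
have -> : (A :\: B) :&: (B :\: A) = finset.set0.
  by apply/setP => i; rewrite !inE; case: (i \in A); case: (i \in B).
rewrite cards0 subn0 -/(symd A B) => ->.
have := cardsID B A; have := cardsID A B; rewrite (finset.setIC B A); lia.
Qed.

End SymmetricDifference.

(** * The Clifford product, the grade involution and the reversion *)

Section CliffordAlgebra.
Variables (K : numFieldType) (n : nat) (eta : 'I_n -> K).
Hypothesis norm_eta : forall i, `|eta i| = 1.
Implicit Types (A B C : {set 'I_n}) (U V X Y : cl K n).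

Local Notation "U ** V" := (cmul eta U V) (at level 40, left associativity).
Local Notation sgn := (csign eta).

(* [csign A B] as a product over [A * B]: transpositions contribute -1,
   coincidences contribute [eta i]. *)
Definition cweight (i j : 'I_n) : K :=
  (if (j < i)%N then -1 else 1) * (if i == j then eta i else 1).

(** In product form, an identity between signs can be checked one pair (i, j) at a time, by cases on
    membership. *)
Lemma csignE A B :
  sgn A B = \prod_i \prod_j (if (i \in A) && (j \in B) then cweight i j else 1).
Proof.
have -> : \prod_i \prod_j (if (i \in A) && (j \in B) then cweight i j else 1) =
  \prod_i \prod_j ((if (i \in A) && (j \in B) && (j < i)%N then -1 else 1) *
    (if (i \in A) && (j \in B) && (i == j) then eta i else 1)).
  apply: eq_bigr => i _; apply: eq_bigr => j _; rewrite /cweight.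
  by case: (_ && _); rewrite /= ?mulr1.
under eq_bigr do rewrite big_split /=.
rewrite big_split /= /csign; congr (_ * _).
  rewrite pair_bigA /= -big_mkcond /= -prodr_const.
  (* The inversion set in [csign] is a classical set, so its membership goes through [asbool]. *)
  by apply: eq_bigl => x; apply/idP/idP; rewrite unfold_in /in_set => /asboolP.
rewrite big_mkcond; apply: eq_bigr => i _; rewrite (bigD1 i) //= eqxx andbT inE.
by rewrite big1 ?mulr1 // => j /negbTE ne; rewrite eq_sym ne andbF.
Qed.

(** This 2-cocycle identity is associativity on blades. Off the diagonal [cweight i j] squares to 1,
    so only exponents modulo 2 matter; with indicators a, b, c both sides have exponent a_i b_j +
    a_i c_j + b_i c_j. *)
Lemma csign_cocycle A B C :
  sgn A B * sgn (symd A B) C = sgn B C * sgn A (symd B C).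
Proof.
rewrite !csignE -!big_split; apply: eq_bigr => i _ /=.
rewrite -!big_split; apply: eq_bigr => j _ /=; rewrite !in_symd.
case: (altP (i =P j)) => [<-|ne].
  by case: (i \in A); case: (i \in B); case: (i \in C); rewrite /= ?mulr1 ?mul1r.
have ww : cweight i j * cweight i j = 1.
  by rewrite /cweight (negbTE ne) mulr1; case: ifP => _; rewrite ?mulrNN mulr1.
by case: (i \in A); case: (i \in B); case: (j \in B); case: (j \in C);
  rewrite /= ?mulr1 ?mul1r.
Qed.

(** Exchanging the factors costs -1 for each pair of distinct entries in A x B; their number |A||B|
    - |A :&: B| has the parity of the exponent. *)
Lemma csign_swap A B : sgn A B = (-1) ^+ (#|A| * #|B| + #|A :&: B|) * sgn B A.
Proof.
rewrite !csignE exprD.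
rewrite [X in _ = _ * X]exchange_big /=.
have -> : (-1) ^+ (#|A| * #|B|) =
    \prod_i \prod_j (if (i \in A) && (j \in B) then -1 else 1) :> K.
  rewrite mulnC exprM -prodr_const big_mkcond; apply: eq_bigr => i _ /=.
  case: (i \in A); rewrite /= ?big1_eq // -prodr_const big_mkcond.
  by apply: eq_bigr.
have -> : (-1) ^+ #|A :&: B| =
  \prod_i \prod_j (if (i \in A) && (j \in B) && (i == j) then -1 else 1) :> K.
  rewrite -prodr_const big_mkcond; apply: eq_bigr => i _ /=.
  rewrite (bigD1 i) //= eqxx andbT inE.
  by rewrite big1 ?mulr1 // => j /negbTE ne; rewrite eq_sym ne andbF.
rewrite -!big_split; apply: eq_bigr => i _ /=.
rewrite -!big_split; apply: eq_bigr => j _ /=.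
rewrite [(j \in B) && _]andbC; case: (_ && _); rewrite /= ?mulr1 //.
rewrite /cweight; case: (ltngtP i j) => [lt|lt|/val_inj->].
- have /negbTE ne : i != j by apply/eqP => e; rewrite e ltnn in lt.
  by rewrite [j == i]eq_sym ne !mulr1 mulrNN mulr1.
- have /negbTE ne : i != j by apply/eqP => e; rewrite e ltnn in lt.
  by rewrite [j == i]eq_sym ne !mulr1.
- by rewrite eqxx !mul1r mulrNN !mul1r.
Qed.

Lemma csign_norm A B : `|sgn A B| = 1.
Proof.
rewrite /csign normrM normrX normrN1 expr1n mul1r normr_prod.
by rewrite big1.
Qed.

Lemma csign_neq0 A B : sgn A B != 0.
Proof. by rewrite -normr_eq0 csign_norm oner_eq0. Qed.

Lemma csign_set0l A : sgn finset.set0 A = 1.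
Proof.
by rewrite csignE big1 // => i _; rewrite big1 // => j _; rewrite inE.
Qed.

Lemma csign_set0r A : sgn A finset.set0 = 1.
Proof.
by rewrite csignE big1 // => i _; rewrite big1 // => j _; rewrite inE andbF.
Qed.

Lemma cmulE U V C :
  (U ** V) C = \sum_A sgn A (symd A C) * U A * V (symd A C).
Proof.
rewrite ffunE; apply: eq_bigr => A _; rewrite (bigD1 (symd A C)) //=.
rewrite -/(symd A (symd A C)) symdK eqxx big1 ?addr0 // => B ne.
case: eqP => // e; case/negP: ne; apply/eqP.
by rewrite e -/(symd A B) symdK.
Qed.

Lemma cmulDl U V X : (U + V) ** X = U ** X + V ** X.
Proof.
apply/ffunP => C; rewrite [RHS]ffunE !cmulE -big_split /=.
by apply: eq_bigr => A _; rewrite ffunE mulrDr mulrDl.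
Qed.

Lemma cmulDr U V X : X ** (U + V) = X ** U + X ** V.
Proof.
apply/ffunP => C; rewrite [RHS]ffunE !cmulE -big_split /=.
by apply: eq_bigr => A _; rewrite ffunE mulrDr.
Qed.

Lemma cmulZl a U X : (a *: U) ** X = a *: (U ** X).
Proof.
apply/ffunP => C; rewrite [RHS]ffunE !cmulE scaler_sumr.
by apply: eq_bigr => A _; rewrite ffunE /GRing.scale /=; ring.
Qed.

Lemma cmulZr a U X : X ** (a *: U) = a *: (X ** U).
Proof.
apply/ffunP => C; rewrite [RHS]ffunE !cmulE scaler_sumr.
by apply: eq_bigr => A _; rewrite ffunE /GRing.scale /=; ring.
Qed.

Lemma cmulNl U X : (- U) ** X = - (U ** X).
Proof. by rewrite -scaleN1r cmulZl scaleN1r. Qed.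

Lemma cmulNr U X : X ** (- U) = - (X ** U).
Proof. by rewrite -scaleN1r cmulZr scaleN1r. Qed.

Lemma cmul0l X : 0 ** X = 0.
Proof. by have := cmulZl 0 0 X; rewrite !scale0r. Qed.

Lemma cmul0r X : X ** 0 = 0.
Proof. by have := cmulZr 0 0 X; rewrite !scale0r. Qed.

Lemma cmul_suml I (r : seq I) P (F : I -> cl K n) X :
  (\sum_(i <- r | P i) F i) ** X = \sum_(i <- r | P i) (F i ** X).
Proof. by elim/big_rec2: _ => [|i y1 y2 _ <-]; rewrite ?cmul0l ?cmulDl. Qed.

Lemma cmul_sumr I (r : seq I) P (F : I -> cl K n) X :
  X ** (\sum_(i <- r | P i) F i) = \sum_(i <- r | P i) (X ** F i).
Proof. by elim/big_rec2: _ => [|i y1 y2 _ <-]; rewrite ?cmul0r ?cmulDr. Qed.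

Lemma blade_sum U : U = \sum_A U A *: blade K A.
Proof.
apply/ffunP => C; rewrite sum_ffunE (bigD1 C) //= big1 ?addr0.
  by rewrite !ffunE eqxx /GRing.scale /= mulr1.
move=> A ne; rewrite !ffunE eq_sym (negbTE ne) /GRing.scale /=.
by rewrite mulr0.
Qed.

Lemma cmul_blade A B : blade K A ** blade K B = sgn A B *: blade K (symd A B).
Proof.
apply/ffunP => C; rewrite cmulE (bigD1 A) //= big1 ?addr0; last first.
  by move=> D ne; rewrite !ffunE (negbTE ne) mulr0 mul0r.
rewrite !ffunE eqxx mulr1 /GRing.scale /=.
have -> : (symd A C == B) = (C == symd A B).
  by apply/eqP/eqP => [<-|->]; rewrite symdK.
by case: eqP => [->|_]; rewrite ?mulr0 // symdK.
Qed.

Lemma cmulA U V X : U ** (V ** X) = U ** V ** X.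
Proof.
rewrite [in LHS](blade_sum U) [in RHS](blade_sum U) !cmul_suml.
apply: eq_bigr => A _; rewrite !cmulZl; congr (_ *: _).
rewrite [in LHS](blade_sum V) [in RHS](blade_sum V) cmul_suml !cmul_sumr cmul_suml.
apply: eq_bigr => B _; rewrite !(cmulZl, cmulZr); congr (_ *: _).
rewrite [in LHS](blade_sum X) [in RHS](blade_sum X) !cmul_sumr.
apply: eq_bigr => C _; rewrite !cmulZr; congr (_ *: _).
rewrite !cmul_blade cmulZl cmulZr !cmul_blade !scalerA symdA.
by rewrite csign_cocycle.
Qed.

Lemma cmul1l U : cone K n ** U = U.
Proof.
rewrite (blade_sum U) cmul_sumr; apply: eq_bigr => A _.
by rewrite cmulZr cmul_blade csign_set0l scale1r symdC symd0.
Qed.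

Lemma cmul1r U : U ** cone K n = U.
Proof.
rewrite (blade_sum U) cmul_suml; apply: eq_bigr => A _.
by rewrite cmulZl cmul_blade csign_set0r scale1r symd0.
Qed.

(** Grade involution, reversion and their composite are all diagonal in the blade basis, so being a
    morphism or an anti-morphism becomes a condition on the signs of symmetric differences. *)
Definition gradescale (s : {set 'I_n} -> K) U : cl K n := [ffun A => s A * U A].

Lemma gradescale_morph s U V :
    (forall A B, s (symd A B) = s A * s B) ->
  gradescale s (U ** V) = gradescale s U ** gradescale s V.
Proof.
move=> sM; apply/ffunP => C; rewrite [LHS]ffunE !cmulE mulr_sumr.
apply: eq_bigr => A _; rewrite -{1}(symdK A C) sM !ffunE; ring.
Qed.

Lemma gradescale_antimorph s U V :
    (forall A B, s (symd A B) = s A * s B * (-1) ^+ (#|A| * #|B| + #|A :&: B|)) ->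
  gradescale s (U ** V) = gradescale s V ** gradescale s U.
Proof.
move=> sM; apply/ffunP => C; rewrite [LHS]ffunE !cmulE mulr_sumr.
(* Since [symd A B = C], replacing the index A by [symd A C] exchanges the two factors. *)
rewrite [RHS](reindex_inj (h := fun A => symd A C)) /=; last first.
  by move=> A B /(congr1 (fun D => symd D C)); rewrite -!symdA symdv !symd0.
apply: eq_bigr => A _; set B := symd A C.
have -> : symd B C = A by rewrite -symdA symdv symd0.
rewrite (csign_swap A B) -{1}(symdK A C) -/B sM.
set e := (-1) ^+ _; rewrite !ffunE.
have ee : e * e = 1 by rewrite -expr2 sqrr_sign.
transitivity ((e * e) * (s A * s B * (sgn B A * U A * V B))); first by ring.
by rewrite ee; ring.
Qed.

Lemma ghatE U : ghat U = gradescale (fun A => (-1) ^+ #|A|) U.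
Proof. by []. Qed.

Lemma crevE U : crev U = gradescale (fun A => (-1) ^+ 'C(#|A|, 2)) U.
Proof.
by apply/ffunP => A; rewrite !ffunE bin2 subn1 divn2.
Qed.

Lemma ghat_crevE U :
  ghat (crev U) = gradescale (fun A => (-1) ^+ (#|A| + 'C(#|A|, 2))) U.
Proof. by rewrite crevE; apply/ffunP => A; rewrite !ffunE exprD mulrA. Qed.

Lemma sign_symd A B : (-1) ^+ #|symd A B| = (-1) ^+ #|A| * (-1) ^+ #|B| :> K.
Proof.
rewrite -exprD -card_symd exprD -muln2 exprM sqrr_sign.
by rewrite mulr1.
Qed.

(** C(a + b, 2) = C(a, 2) + C(b, 2) + ab accounts for |A||B|; passing from |A| + |B| to |symd A B|
    lowers the argument by 2|A :&: B|, which flips the parity |A :&: B| times. *)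
Lemma rev_sign_symd A B :
  (-1) ^+ 'C(#|symd A B|, 2) =
  (-1) ^+ 'C(#|A|, 2) * (-1) ^+ 'C(#|B|, 2) *
  (-1) ^+ (#|A| * #|B| + #|A :&: B|) :> K.
Proof.
rewrite -!exprD -signr_odd -[RHS]signr_odd; congr (_ ^+ nat_of_bool _).
have := odd_bin2_shift #|symd A B| #|A :&: B|; rewrite card_symd bin2_add.
rewrite !oddD; move: (odd 'C(#|symd A B|, 2)) (odd #|A :&: B|) => x y e.
by rewrite addbA e -addbA addbb addbF.
Qed.

Lemma ghatM U V : ghat (U ** V) = ghat U ** ghat V.
Proof. by rewrite !ghatE gradescale_morph //; exact: sign_symd. Qed.

Lemma crevM U V : crev (U ** V) = crev V ** crev U.
Proof. by rewrite !crevE gradescale_antimorph //; exact: rev_sign_symd. Qed.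

Lemma gradescale_one s : s finset.set0 = 1 -> gradescale s (cone K n) = cone K n.
Proof.
by move=> s0; apply/ffunP => A; rewrite !ffunE; case: eqP => [->|_];
  rewrite ?mulr0 // s0 mulr1.
Qed.

Lemma ghat_one : ghat (cone K n) = cone K n.
Proof. by rewrite ghatE gradescale_one ?cards0. Qed.

Lemma crev_one : crev (cone K n) = cone K n.
Proof. by rewrite crevE gradescale_one ?cards0. Qed.

End CliffordAlgebra.

(** * An l1 norm and the iterates of two-sided multiplication *)

Section Norm.
Variables (K : numFieldType) (n : nat) (eta : 'I_n -> K).
Hypothesis norm_eta : forall i, `|eta i| = 1.
Implicit Types (A B C : {set 'I_n}) (U V X Y : cl K n).

Local Notation "U ** V" := (cmul eta U V) (at level 40, left associativity).

Definition cnorm U : K := \sum_A `|U A : K|.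

Lemma cnorm_ge0 U : 0 <= cnorm U.
Proof. by apply: sumr_ge0 => A _; exact: normr_ge0. Qed.

Lemma cnorm_coord U C : `|U C : K| <= cnorm U.
Proof.
by rewrite /cnorm (bigD1 C) //= lerDl sumr_ge0 // => A _; exact: normr_ge0.
Qed.

Lemma cnormD U V : cnorm (U + V) <= cnorm U + cnorm V.
Proof.
rewrite /cnorm -big_split /=; apply: ler_sum => A _.
by rewrite ffunE; exact: ler_normD.
Qed.

Lemma cnormM U V : cnorm (U ** V) <= cnorm U * cnorm V.
Proof.
apply: (@le_trans _ _ (\sum_C \sum_A `|U A : K| * `|V (symd A C) : K|)).
  apply: ler_sum => C _; rewrite cmulE.
  apply: (le_trans (ler_norm_sum _ _ _)); apply: ler_sum => A _.
  by rewrite normrM normrM csign_norm // mul1r.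
rewrite exchange_big /cnorm mulr_suml /=; apply: ler_sum => A _.
rewrite -mulr_sumr; apply: ler_wpM2l; first exact: normr_ge0.
rewrite [X in _ <= X](reindex_inj (h := symd A)) //=.
by move=> B C /(congr1 (symd A)); rewrite !symdK.
Qed.

Lemma cnorm_one : cnorm (cone K n) = 1.
Proof.
rewrite /cnorm (bigD1 finset.set0) //= big1 ?ffunE ?eqxx ?normr1 ?addr0 //.
by move=> A ne; rewrite ffunE (negbTE ne) normr0.
Qed.

Lemma cpowS U k : cpow eta U k.+1 = U ** cpow eta U k.
Proof. by []. Qed.

Lemma cpowSr U k : cpow eta U k.+1 = cpow eta U k ** U.
Proof.
by elim: k => [|k IH]; rewrite ?cpowS /= ?cmul1l ?cmul1r // -cmulA -IH.
Qed.

Lemma cnorm_pow U k : cnorm (cpow eta U k) <= cnorm U ^+ k.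
Proof.
elim: k => [|k IH]; first by rewrite cnorm_one.
rewrite cpowS exprS; apply: (le_trans (cnormM _ _)).
by apply: ler_wpM2l => //; exact: cnorm_ge0.
Qed.

Definition twoside U V X := U ** X + X ** V.

Lemma cnorm_iter_twoside U V X k :
  cnorm (iter k (twoside U V) X) <= (cnorm U + cnorm V) ^+ k * cnorm X.
Proof.
elim: k => [|k IH]; first by rewrite mul1r.
rewrite iterS exprS -mulrA; apply: (le_trans (cnormD _ _)).
apply: (@le_trans _ _ ((cnorm U + cnorm V) * cnorm (iter k (twoside U V) X))).
  by rewrite mulrDl lerD //; [|rewrite mulrC]; exact: cnormM.
by apply: ler_wpM2l => //; rewrite addr_ge0 ?cnorm_ge0.
Qed.

Lemma twosideZ a U V X : twoside U V (a *: X) = a *: twoside U V X.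
Proof. by rewrite /twoside cmulZl cmulZr scalerDr. Qed.

Lemma iter_twosideZ a U V X k :
  iter k (twoside (a *: U) (a *: V)) X = a ^+ k *: iter k (twoside U V) X.
Proof.
elim: k => [|k IH]; first by rewrite scale1r.
rewrite !iterS IH twosideZ /twoside !cmulZl !cmulZr -scalerDr scalerA.
by rewrite -exprSr.
Qed.

(** With X = 1, additivity of exp on commuting elements becomes a special case of the formula for
    exp(U) X exp(V). *)
Lemma iter_twoside_comm U V k : U ** V = V ** U ->
  iter k (twoside U V) (cone K n) = cpow eta (U + V) k.
Proof.
move=> UV; elim: k => [//|k IH]; rewrite iterS IH /twoside.
have -> : cpow eta (U + V) k ** V = V ** cpow eta (U + V) k.
  elim: k {IH} => [|k IH]; first by rewrite cmul1l cmul1r.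
  by rewrite cpowS -cmulA IH !cmulA cmulDl cmulDr UV.
by rewrite -cmulDl.
Qed.

(** The (i, j) term of the double series for exp(U) X exp(V). *)
Definition wterm U V X i j : cl K n :=
  ((i`!)%:R * (j`!)%:R)^-1 *: (cpow eta U i ** X ** cpow eta V j).

Lemma natrS_neq0 k : (k.+1)%:R != 0 :> K.
Proof. by rewrite pnatr_eq0. Qed.

Lemma wterm_l U V X i j : U ** wterm U V X i j = i.+1%:R *: wterm U V X i.+1 j.
Proof.
rewrite /wterm cmulZr scalerA !cmulA -cpowS; congr (_ *: _).
by rewrite factS natrM -mulrA [in RHS]invfM mulVKf ?natrS_neq0.
Qed.

Lemma wterm_r U V X i j : wterm U V X i j ** V = j.+1%:R *: wterm U V X i j.+1.
Proof.
rewrite /wterm cmulZl scalerA -cmulA -cpowSr; congr (_ *: _).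
by rewrite factS natrM mulrCA [in RHS]invfM mulVKf ?natrS_neq0.
Qed.

(* Left and right multiplication commute, so this is the binomial formula. *)
Lemma iter_twosideE U V X k :
  (k`!)%:R^-1 *: iter k (twoside U V) X = \sum_(i < k.+1) wterm U V X i (k - i).
Proof.
elim: k => [|k IH].
  by rewrite big_ord1 /wterm /= cmul1l cmul1r mulr1.
rewrite factS natrM invfM -scalerA iterS -twosideZ IH /twoside.
rewrite cmul_sumr cmul_suml.
(* Both sums are extended to [k.+2] terms: the added end term has coefficient 0, and the weights i
   and k + 1 - i add up to k + 1. *)
transitivity ((k.+1)%:R^-1 *: ((\sum_(i < k.+2) i%:R *: wterm U V X i (k.+1 - i)) +
   \sum_(i < k.+2) (k.+1 - i)%:R *: wterm U V X i (k.+1 - i))).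
  congr (_ *: (_ + _)).
    rewrite [RHS]big_ord_recl scale0r add0r; apply: eq_bigr => i _.
    by rewrite wterm_l lift0 subSS.
  rewrite [RHS]big_ord_recr /= subnn scale0r addr0; apply: eq_bigr => i _.
  by rewrite wterm_r subSn // -ltnS.
rewrite -big_split scaler_sumr; apply: eq_bigr => i _ /=.
by rewrite -scalerDl -natrD subnKC ?leq_ord // scalerA mulVf ?scale1r ?natrS_neq0.
Qed.

Lemma sum_triangle (M : zmodType) (F : nat -> nat -> M) m :
  \sum_(k < m) \sum_(i < k.+1) F i (k - i)%N =
  \sum_(i < m) \sum_(j < m | (i + j < m)%N) F i j.
Proof.
transitivity (\sum_(k < m) \sum_(i < m | (i < k.+1)%N) F i (k - i)%N).
  by apply: eq_bigr => k _; rewrite (big_ord_widen m (fun i => F i (k - i)%N)).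
rewrite (exchange_big_dep predT) //=; apply: eq_bigr => i _.
transitivity (\sum_(i <= k < m) F i (k - i)%N).
  rewrite big_geq_mkord; apply: eq_bigl => k; by rewrite ltnS.
rewrite -{1}[i : nat]add0n big_addn big_mkord.
rewrite (big_ord_widen_cond m predT (fun j => F i (j + i - i)%N)) ?leq_subr //.
by apply: eq_big => [j|j _]; [rewrite /= ltn_subRL | rewrite addnK].
Qed.
End Norm.

(** * Scalars over which the exponential series converges *)

Lemma sum_expr_fact_le (R : realType) (x : R) m :
  0 <= x -> \sum_(k < m) x ^+ k / (k`!)%:R <= expR x.
Proof.
move=> x0; rewrite -(big_mkord xpredT (fun k => x ^+ k / (k`!)%:R)).
apply: (@nondecreasing_cvgn_le R (series (exp_coeff x))).
  apply/nondecreasing_seqP => k; rewrite /series /= big_nat_recr //= lerDl.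
  by rewrite mulr_ge0 ?invr_ge0 ?ler0n ?exprn_ge0.
exact: is_cvg_series_exp_coeff.
Qed.

(* What is needed of the scalars in order to run the exponential series of a
   Clifford algebra over [K]; it holds for [R] and for [R[i]]. *)
Record exp_scalars (R : realType) (K : numFieldType) (emb : {rmorphism R -> K}) :=
  ExpScalars {
  emb_norm : forall x, `|emb x| = emb `|x|;
  emb_bound : forall x : K, exists r : R, `|x| <= emb r;
  emb_cvg : forall (a : nat -> K) (c M : R),
    (forall k, `|a k| <= emb (c * (M ^+ k / (k`!)%:R))) ->
    cvgn (fun m => \sum_(k < m) a k : K^o) }.

Section ExpScalars.
Variables (R : realType) (K : numFieldType) (emb : {rmorphism R -> K}).
Hypothesis hK : exp_scalars emb.

Lemma emb_le x y : x <= y -> emb x <= emb y.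
Proof.
rewrite -subr_ge0 -(subr_ge0 (emb x)) -rmorphB => xy.
by rewrite -(ger0_norm xy) -emb_norm // normr_ge0.
Qed.

Lemma emb_lt x y : x < y -> emb x < emb y.
Proof.
move=> xy; rewrite lt_neqAle emb_le ?ltW // andbT.
by rewrite (inj_eq (fmorph_inj emb)) lt_eqF.
Qed.

Lemma emb_bound0 (x : K) : exists2 r : R, 0 <= r & `|x| <= emb r.
Proof.
have [r hr] := emb_bound hK x; exists `|r| => //.
by apply: (le_trans hr); apply: emb_le; exact: ler_norm.
Qed.

(** [K] is not assumed archimedean; the bound of |d^-1| by some [emb r] takes the place of that,
    since for nonzero d it gives 1 <= r t B for all small t. *)
Lemma emb_small (d : K) (B : R) :
  (forall t, 0 < t -> t <= 1 -> `|d| <= emb (t * B)) -> d = 0.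
Proof.
move=> h; apply/eqP/negP => /negP d0.
have [r r0 hr] := emb_bound0 d^-1.
have h1 t : 0 < t -> t <= 1 -> ~ (r * (t * B) < 1).
  move=> t0 t1 lt1; have : (1 : K) < 1; last by rewrite ltxx.
  rewrite -{2}(rmorph1 emb); apply: le_lt_trans (emb_lt lt1).
  rewrite rmorphM -(normr1 K) -(mulVf d0) normrM.
  by apply: ler_pM => //; exact: h.
have rB : r * B <= r * `|B| by rewrite ler_wpM2l ?ler_norm.
have rB0 : 0 <= r * `|B| by rewrite mulr_ge0.
(* The 1 in the denominator keeps t <= 1 and makes r t B < 1 strict. *)
apply: (h1 (1 + r * `|B|)^-1).
- by rewrite invr_gt0; lra.
- by rewrite invf_le1; lra.
- have -> : r * ((1 + r * `|B|)^-1 * B) = (r * B) / (1 + r * `|B|) by ring.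
  by rewrite ltr_pdivrMr; lra.
Qed.

(** A bound |e^-1| <= [emb r] reduces |u m| < e in [K] to r c 2^-m < 1, a limit in [R]. *)
Lemma cvg_emb_small (u : nat -> K) (c : R) :
  (forall m, `|u m| <= emb (c * 2^-1 ^+ m)) ->
  ((u m : K^o) @[m --> \oo] --> (0 : K^o))%classic.
Proof.
move=> h; apply/cvgrPdist_lt => e e0.
have [r r0 hr] := emb_bound0 e^-1.
have : ((r * c) * 2^-1 ^+ m @[m --> \oo] --> (0 : R))%classic.
  apply: cvg_geometric; rewrite ger0_norm; lra.
move/cvgrPdist_lt/(_ 1 ltr01); apply: filterS => m /=.
rewrite sub0r normrN => lt1.
rewrite sub0r normrN.
have hm : r * (c * 2^-1 ^+ m) < 1.
  by rewrite mulrA; apply: le_lt_trans lt1; exact: ler_norm.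
have e1 : e^-1 <= emb r by apply: le_trans hr; rewrite ger0_norm // invr_ge0 ltW.
rewrite -(ltr_pM2l (x := e^-1)) ?invr_gt0 // mulVf ?gt_eqF //.
apply: (@le_lt_trans _ _ (emb r * `|u m|)); first by rewrite ler_wpM2r.
apply: (@le_lt_trans _ _ (emb r * emb (c * 2^-1 ^+ m))).
  by rewrite ler_wpM2l // -(rmorph0 emb) emb_le.
by rewrite -rmorphM -(rmorph1 emb) emb_lt.
Qed.

End ExpScalars.

(** * The exponential and the formula for exp(U) X exp(V) *)

Section Exponential.
Variables (R : realType) (K : numFieldType) (emb : {rmorphism R -> K}).
Hypothesis hK : exp_scalars emb.
Variables (n : nat) (eta : 'I_n -> K).
Hypothesis norm_eta : forall i, `|eta i| = 1.
Implicit Types (A B C : {set 'I_n}) (U V X Y : cl K n).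

Local Notation "U ** V" := (cmul eta U V) (at level 40, left associativity).

Lemma cvg_sum_seq (I : Type) (r : seq I) (u : nat -> I -> K) (l : I -> K) :
  (forall i, ((u m i : K^o) @[m --> \oo] --> (l i : K^o))%classic) ->
  ((\sum_(i <- r) u m i : K^o) @[m --> \oo] --> (\sum_(i <- r) l i : K^o))%classic.
Proof.
move=> h; elim: r => [|i r IH].
  by rewrite big_nil; under eq_fun do rewrite big_nil; exact: cvg_cst.
rewrite big_cons; under eq_fun do rewrite big_cons.
exact: (@cvgD K K^o _ _ _ (fun m => u m i) (fun m => \sum_(i <- r) u m i)).
Qed.

Lemma cvg_cmul (u v : nat -> cl K n) U V C :
  (forall A, (u m A @[m --> \oo] --> U A)%classic) ->
  (forall A, (v m A @[m --> \oo] --> V A)%classic) ->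
  ((u m ** v m) C @[m --> \oo] --> (U ** V) C)%classic.
Proof.
move=> hu hv; rewrite cmulE; under eq_fun do rewrite cmulE.
apply: (@cvg_sum_seq _ _ (fun m A => csign eta A (symd A C) * u m A * v m (symd A C))).
move=> A; apply: (@cvgM K nat \oo%classic _ (fun m => csign eta A (symd A C) * u m A)
                        (fun m => v m (symd A C))); last exact: hv.
by apply: (@cvgM K nat \oo%classic _ (fun=> csign eta A (symd A C)) (fun m => u m A));
  [exact: cvg_cst | exact: hu].
Qed.

Definition epart U m : cl K n := \sum_(k < m) (k`!)%:R^-1 *: cpow eta U k.

Lemma epartE U m C : epart U m C = \sum_(k < m) (cpow eta U k C / (k`!)%:R : K^o).
Proof.
rewrite sum_ffunE; apply: eq_bigr => k _; rewrite ffunE /GRing.scale /=.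
by rewrite mulrC.
Qed.

Lemma cnorm_bound U : exists2 r : R, 0 <= r & cnorm U <= emb r.
Proof.
have [r r0 hr] := emb_bound0 hK (cnorm U); exists r => //.
by move: hr; rewrite ger0_norm ?cnorm_ge0.
Qed.

Lemma cvg_epart U C : (epart U m C @[m --> \oo] --> cexp eta U C)%classic.
Proof.
have [r r0 hr] := cnorm_bound U.
rewrite ffunE; under eq_fun do rewrite epartE.
apply: (@emb_cvg _ _ _ hK (fun k => cpow eta U k C / (k`!)%:R) 1 r) => k.
rewrite normrM normfV normr_nat mul1r rmorphM fmorphV rmorph_nat rmorphXn /=.
rewrite ler_wpM2r ?invr_ge0 ?ler0n //.
apply: (le_trans (cnorm_coord _ _)); apply: (le_trans (cnorm_pow norm_eta _ _)).
by apply: lerXn2r => //; rewrite nnegrE ?cnorm_ge0 // (le_trans (cnorm_ge0 U)).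
Qed.

Lemma wterm_bound U V X : exists c a b : R, [/\ 0 <= c, 0 <= a, 0 <= b &
  forall i j C, `|wterm eta U V X i j C : K| <=
    emb (c * (a ^+ i / (i`!)%:R * (b ^+ j / (j`!)%:R)))].
Proof.
have [a a0 ha] := cnorm_bound U; have [b b0 hb] := cnorm_bound V.
have [c c0 hc] := cnorm_bound X; exists c, a, b; split=> // i j C.
rewrite /wterm ffunE /GRing.scale /= normrM normfV normrM !normr_nat.
apply: (@le_trans _ _ ((i`!%:R * j`!%:R)^-1 * (emb a ^+ i * emb c * emb b ^+ j))).
  rewrite ler_wpM2l ?invr_ge0 ?mulr_ge0 ?ler0n //.
  apply: (le_trans (cnorm_coord _ _)); apply: (le_trans (cnormM norm_eta _ _)).
  have pw W r k : cnorm W <= emb r -> cnorm (cpow eta W k) <= emb r ^+ k.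
    move=> hW; apply: (le_trans (cnorm_pow norm_eta _ _)).
    by apply: lerXn2r => //; rewrite nnegrE ?cnorm_ge0 // (le_trans (cnorm_ge0 W)).
  apply: ler_pM; rewrite ?cnorm_ge0 ?pw //.
  apply: (le_trans (cnormM norm_eta _ _)).
  by apply: ler_pM; rewrite ?cnorm_ge0 ?pw.
rewrite !(rmorphM, fmorphV, rmorphXn, rmorph_nat) /= le_eqVlt; apply/orP; left.
by apply/eqP; rewrite invfM; ring.
Qed.

(** Doubling both bases multiplies the term by 2^(i+j) >= 2^m, and the double series with doubled
    bases is still bounded by exp(2a) exp(2b). *)
Lemma half_tail (a b : R) (i j m : nat) : 0 <= a -> 0 <= b -> (m <= i + j)%N ->
  a ^+ i / (i`!)%:R * (b ^+ j / (j`!)%:R) <=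
  2^-1 ^+ m * ((a *+ 2) ^+ i / (i`!)%:R * ((b *+ 2) ^+ j / (j`!)%:R)).
Proof.
move=> a0 b0 mij; rewrite -[a *+ 2]mulr_natl -[b *+ 2]mulr_natl !exprMn.
have -> : 2^-1 ^+ m * (2 ^+ i * a ^+ i / i`!%:R * (2 ^+ j * b ^+ j / j`!%:R)) =
  (2^-1 ^+ m * 2 ^+ (i + j)) * (a ^+ i / (i`!)%:R * (b ^+ j / (j`!)%:R)).
  by rewrite exprD; ring.
rewrite ler_peMl ?mulr_ge0 ?invr_ge0 ?ler0n ?exprn_ge0 //.
rewrite exprVn -(subnKC mij) exprD mulKf ?expf_neq0 ?pnatr_eq0 //.
by rewrite exprn_ege1 // ler1n.
Qed.

(* The square partial sums of the double series differ from the triangular ones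
   by terms with [m <= i + j], where [half_tail] gains a factor [2^-m]. *)
Lemma cvg_wterm_tail U V X C :
  ((\sum_(i < m) \sum_(j < m | ~~ (i + j < m)%N) wterm eta U V X i j C : K^o)
     @[m --> \oo] --> (0 : K^o))%classic.
Proof.
have [c [a [b [c0 a0 b0 h]]]] := wterm_bound U V X.
apply: (@cvg_emb_small _ _ _ hK _ (c * (expR (a *+ 2) * expR (b *+ 2)))) => m.
pose F (i j : nat) : R := (a *+ 2) ^+ i / (i`!)%:R * ((b *+ 2) ^+ j / (j`!)%:R).
have F0 i j : 0 <= F i j.
  by rewrite !mulr_ge0 ?invr_ge0 ?ler0n ?exprn_ge0 ?mulrn_wge0.
apply: (@le_trans _ _ (emb (\sum_(i < m) \sum_(j < m) c * (2^-1 ^+ m * F i j)))).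
  rewrite rmorph_sum; apply: (le_trans (ler_norm_sum _ _ _)); apply: ler_sum => i _.
  rewrite rmorph_sum /=; apply: (le_trans (ler_norm_sum _ _ _)).
  rewrite big_mkcond /=; apply: ler_sum => j _; case: ifP; rewrite -?leqNgt => ij.
    by apply: (le_trans (h _ _ _)); apply: (emb_le hK); rewrite ler_wpM2l ?half_tail.
  by rewrite -(rmorph0 emb) (emb_le hK) // mulr_ge0 // mulr_ge0 // exprn_ge0 // invr_ge0 ler0n.
apply: (emb_le hK).
under eq_bigr do rewrite -mulr_sumr -mulr_sumr -mulr_sumr.
rewrite -mulr_sumr -mulr_sumr -mulr_suml -mulrA ler_wpM2l // mulrC.
rewrite ler_wpM2r ?exprn_ge0 ?invr_ge0 ?ler0n //.
by apply: ler_pM; rewrite ?sumr_ge0 ?sum_expr_fact_le ?mulrn_wge0 // => k _;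
  rewrite !mulr_ge0 ?invr_ge0 ?ler0n ?exprn_ge0 ?mulrn_wge0.
Qed.

Lemma cvg_twoside U V X C :
  ((\sum_(k < m) (iter k (twoside eta U V) X C / (k`!)%:R : K^o))
     @[m --> \oo] --> (cexp eta U ** X ** cexp eta V) C)%classic.
Proof.
(* The triangular sum is the product of the partial sums minus a tail; the product converges by
   continuity of multiplication, and the tail tends to 0. *)
have E m : \sum_(k < m) (iter k (twoside eta U V) X C / (k`!)%:R : K^o) =
    (epart U m ** X ** epart V m) C
    - \sum_(i < m) \sum_(j < m | ~~ (i + j < m)%N) wterm eta U V X i j C.
  have -> : \sum_(k < m) (iter k (twoside eta U V) X C / (k`!)%:R : K^o) =
     (\sum_(k < m) (k`!)%:R^-1 *: iter k (twoside eta U V) X) C.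
    rewrite sum_ffunE; apply: eq_bigr => k _; rewrite ffunE /GRing.scale /=.
    by rewrite mulrC.
  under eq_bigr do rewrite iter_twosideE.
  rewrite (sum_triangle (wterm eta U V X)).
  have -> : epart U m ** X ** epart V m = \sum_(i < m) \sum_(j < m) wterm eta U V X i j.
    rewrite /epart !cmul_suml; apply: eq_bigr => i _.
    rewrite cmul_sumr; apply: eq_bigr => j _.
    by rewrite /wterm invfM !cmulZl cmulZr scalerA.
  rewrite !sum_ffunE -sumrB; apply: eq_bigr => i _; rewrite !sum_ffunE.
  by rewrite [in RHS](bigID (fun j : 'I_m => (i + j < m)%N)) /= addrK.
under eq_fun do rewrite E.
rewrite -[(cexp eta U ** X ** cexp eta V) C]subr0.
apply: (@cvgB K K^o _ _ _ (fun m => (epart U m ** X ** epart V m) C)); last first.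
  exact: cvg_wterm_tail.
apply: cvg_cmul => A; last exact: cvg_epart.
by apply: (@cvg_cmul _ (fun=> X)) => B; [exact: cvg_epart | exact: cvg_cst].
Qed.

Lemma twoside_exp U V X C :
  (cexp eta U ** X ** cexp eta V) C =
  limn (fun m => \sum_(k < m) (iter k (twoside eta U V) X C / (k`!)%:R : K^o)).
Proof.
apply/esym; apply: cvg_lim; last exact: cvg_twoside.
exact: (@norm_hausdorff K K^o).
Qed.

(** A coordinate outside P vanishes on every D^k X, so its limit is that of the zero sequence. *)
Lemma twoside_exp_grades P U V X :
  grades P X -> (forall Y, grades P Y -> grades P (twoside eta U V Y)) ->
  grades P (cexp eta U ** X ** cexp eta V).
Proof.
move=> PX PD C; apply: contraNT => nP; rewrite twoside_exp.
have Pk k : iter k (twoside eta U V) X C = 0.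
  have : grades P (iter k (twoside eta U V) X).
    by elim: k => [//|k IH]; apply: PD.
  by move/(_ C) => h; apply/eqP; apply: contraNT nP => /h.
under eq_fun do (under eq_bigr do rewrite Pk mul0r); under eq_fun do rewrite big1_eq.
by rewrite lim_cst //; exact: (@norm_hausdorff K K^o).
Qed.

(* First-order term of [exp(tU) X exp(tV) = X + t (UX + XV) + O(t^2)]. *)
Lemma twoside_grades_deriv P U V X : grades P X ->
  (forall t : R, grades P (cexp eta (emb t *: U) ** X ** cexp eta (emb t *: V))) ->
  grades P (twoside eta U V X).
Proof.
move=> PX PE C; apply: contraNT => nP; apply/eqP.
have X0 : X C = 0 by apply/eqP; apply: contraNT nP => /PX.
have [a a0 ha] := cnorm_bound U; have [b b0 hb] := cnorm_bound V.
have [c c0 hc] := cnorm_bound X.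
pose d k : K := iter k (twoside eta U V) X C.
have hd k : `|d k| <= emb ((a + b) ^+ k * c).
  apply: (le_trans (cnorm_coord _ _)); apply: (le_trans (cnorm_iter_twoside norm_eta _ _ _ _)).
  rewrite rmorphM rmorphXn rmorphD; apply: ler_pM => //.
  - by rewrite exprn_ge0 // addr_ge0 ?cnorm_ge0.
  - exact: cnorm_ge0.
  - by apply: lerXn2r; rewrite ?nnegrE ?addr_ge0 ?cnorm_ge0 ?lerD //
      -(rmorph0 emb) (emb_le hK).
have d0 : d 0%N = 0 by [].
rewrite -[twoside eta U V X C]/(d 1%N).
(* The 1 pays for stopping the series at a finite index with error below t^2; [expR (a + b) * c]
   bounds the terms of order k >= 2, where t^k <= t^2. *)
apply: (@emb_small _ _ _ hK _ (1 + expR (a + b) * c)) => t t0 t1.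
have lim0 : ((\sum_(k < m) (emb t ^+ k * d k / (k`!)%:R : K^o)) @[m --> \oo]
          --> (0 : K^o))%classic.
  have Z : (cexp eta (emb t *: U) ** X ** cexp eta (emb t *: V)) C = 0.
    by apply/eqP; apply: contraNT nP => /PE.
  have := @cvg_twoside (emb t *: U) (emb t *: V) X C; rewrite Z.
  by under eq_fun do (under eq_bigr do rewrite iter_twosideZ ffunE).
have et2 : 0 < emb (t ^+ 2) by rewrite -(rmorph0 emb) (emb_lt hK) // exprn_gt0.
move: d hd d0 lim0 => d hd d0 /cvgrPdist_lt/(_ _ et2) [N _ hN].
have {hN} := hN N.+2 (leqW (leqnSn N)).
rewrite /= sub0r normrN 2!big_ord_recl d0 mulr0 mul0r add0r expr1 divr1.
set S := \sum_(i < N) _ => hS.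
have S_le : `|S| <= emb (t ^+ 2 * (expR (a + b) * c)).
  apply: (@le_trans _ _ (emb (\sum_(k < N.+2) t ^+ 2 * ((a + b) ^+ k / (k`!)%:R * c)))).
    rewrite rmorph_sum 2!big_ord_recl /= addrA; apply: ler_wpDl.
      by rewrite -rmorphD -(rmorph0 emb) (emb_le hK) // addr_ge0 //
        !mulr_ge0 ?exprn_ge0 ?addr_ge0 ?invr_ge0 ?ler0n // ltW.
    apply: (le_trans (ler_norm_sum _ _ _)); apply: ler_sum => k _.
    rewrite /bump /= !add1n normrM normrM normfV normr_nat normrX (emb_norm hK).
    rewrite (gtr0_norm t0) -[X in emb (_ * X)]mulrAC mulrA rmorphM fmorphV rmorph_nat.
    rewrite ler_wpM2r ?invr_ge0 ?ler0n // rmorphM.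
    apply: ler_pM => //.
    - by rewrite -rmorphXn -(rmorph0 emb) (emb_le hK) // exprn_ge0 // ltW.
    - rewrite -rmorphXn (emb_le hK) //.
      by apply: ler_wiXn2l => //; exact: ltW.
  apply: (emb_le hK); rewrite -mulr_sumr -mulr_suml ler_wpM2l ?sqr_ge0 //.
  by rewrite ler_wpM2r // sum_expr_fact_le // addr_ge0.
have et0 : 0 < emb t by rewrite -(rmorph0 emb) (emb_lt hK).
rewrite -(ler_pM2l et0) -{1}(gtr0_norm et0) -normrM -rmorphM.
have -> : emb t * d 1%N = (emb t * d 1%N + S) - S by rewrite addrK.
apply: (le_trans (ler_normB _ _)).
have -> : t * (t * (1 + expR (a + b) * c)) = t ^+ 2 + t ^+ 2 * (expR (a + b) * c).
  by ring.
by rewrite rmorphD lerD // ltW.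
Qed.

Lemma cexp0 : cexp eta 0 = cone K n.
Proof.
apply/ffunP => C; rewrite ffunE.
have E m : (\sum_(k < m.+1) (cpow eta 0 k C / (k`!)%:R : K^o)) = cone K n C.
  rewrite big_ord_recl big1 ?addr0 ?divr1 // => i _.
  have -> : cpow eta 0 (lift ord0 i) = 0 by rewrite lift0 cpowS cmul0l.
  by rewrite ffunE mul0r.
apply: cvg_lim; first exact: (@norm_hausdorff K K^o).
apply/cvgrPdist_lt => e e0; exists 1%N => // -[//|m] _ /=.
by rewrite E subrr normr0.
Qed.

Lemma cexpD U V : U ** V = V ** U -> cexp eta U ** cexp eta V = cexp eta (U + V).
Proof.
move=> UV; apply/ffunP => C.
rewrite -{1}(cmul1r eta (cexp eta U)) twoside_exp [RHS]ffunE.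
by under eq_fun do (under eq_bigr do rewrite iter_twoside_comm //).
Qed.

Lemma cexpNr U : cexp eta U ** cexp eta (- U) = cone K n.
Proof. by rewrite cexpD ?subrr ?cexp0 // cmulNl cmulNr. Qed.

Lemma cexpNl U : cexp eta (- U) ** cexp eta U = cone K n.
Proof. by rewrite cexpD ?addNr ?cexp0 // cmulNl cmulNr. Qed.

(** The hypothesis concerns powers only, which automorphisms and anti-automorphisms preserve
    alike. *)
Lemma gradescale_cexp s U :
  (forall k, gradescale s (cpow eta U k) = cpow eta (gradescale s U) k) ->
  gradescale s (cexp eta U) = cexp eta (gradescale s U).
Proof.
move=> h; apply/ffunP => C; rewrite [LHS]ffunE [RHS]ffunE.
apply/esym/cvg_lim; first exact: (@norm_hausdorff K K^o).
have E m : \sum_(k < m) (cpow eta (gradescale s U) k C / (k`!)%:R : K^o) =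
    s C * epart U m C.
  by rewrite epartE mulr_sumr; apply: eq_bigr => k _; rewrite -h [in LHS]ffunE mulrA.
under eq_fun do rewrite E.
apply: (@cvgM K nat \oo%classic _ (fun=> s C) (fun m => epart U m C)).
  exact: cvg_cst.
exact: cvg_epart.
Qed.

Lemma ghat_cexp U : ghat (cexp eta U) = cexp eta (ghat U).
Proof.
apply: gradescale_cexp; elim=> [|k IH]; first exact: ghat_one.
by rewrite !cpowS -[LHS]/(ghat _) ghatM; congr (_ ** _); exact: IH.
Qed.

Lemma crev_cexp U : crev (cexp eta U) = cexp eta (crev U).
Proof.
rewrite !crevE; apply: gradescale_cexp; elim=> [|k IH].
  by rewrite -crevE crev_one.
by rewrite cpowS cpowSr -IH -!crevE crevM.
Qed.

End Exponential.

(** * Grade subspaces, commutation of blades and the center *)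

Section Grades.
Variables (K : numFieldType) (n : nat) (eta : 'I_n -> K).
Hypothesis norm_eta : forall i, `|eta i| = 1.
Implicit Types (A B C : {set 'I_n}) (U V X Y : cl K n) (P Q : nat -> bool).

Local Notation "U ** V" := (cmul eta U V) (at level 40, left associativity).
Local Notation sgn := (csign eta).
Local Notation center := (@Defs.center K n).
Local Notation inv_pair := (@Defs.inv_pair K n eta).

Lemma card_ord_le A : (#|A| <= n)%N.
Proof. by rewrite -[X in (_ <= X)%N]card_ord max_card. Qed.

Lemma card_eqn A : (#|A| == n) = (A == finset.setT).
Proof.
apply/eqP/eqP => [cA|->]; last by rewrite cardsT card_ord.
by apply/eqP; rewrite eqEcard finset.subsetT cardsT card_ord cA leqnn.
Qed.

Lemma grades_sub P Q : (forall k, (k <= n)%N -> P k -> Q k) ->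
  (grades P `<=` @grades K n Q)%classic.
Proof. by move=> PQ U PU A /PU; apply: PQ; exact: card_ord_le. Qed.

Lemma grades_eq P Q : (forall k, (k <= n)%N -> P k = Q k) ->
  @grades K n P = grades Q.
Proof.
by move=> PQ; apply/seteqP; split; apply: grades_sub => k kn; rewrite PQ.
Qed.

Lemma gradesZ P a U : grades P U -> grades P (a *: U).
Proof.
move=> PU A; rewrite ffunE; apply: contraNT => nP.
have -> : U A = 0 by apply/eqP; apply: contraNT nP => /PU.
by rewrite scaler0.
Qed.

Lemma gradescale_grades P s U : grades P U -> grades P (gradescale s U).
Proof.
by move=> PU A; rewrite ffunE mulf_eq0 negb_or => /andP[_]; exact: PU.
Qed.

Lemma gradescaleZ s a U : gradescale s (a *: U) = a *: gradescale s U.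
Proof. by apply/ffunP => A; rewrite !ffunE /GRing.scale /= mulrCA. Qed.

Lemma grades_blade P A : grades P (blade K A) <-> P #|A|.
Proof.
split=> [/(_ A)|PA B]; first by apply; rewrite ffunE eqxx oner_eq0.
by rewrite ffunE; case: (altP (B =P A)) => [->|_]; rewrite ?eqxx.
Qed.

Lemma clB U V A : (U - V) A = U A - V A.
Proof. by rewrite !ffunE. Qed.

Lemma cmulE_r U V C :
  (V ** U) C = \sum_A sgn (symd A C) A * V (symd A C) * U A.
Proof.
rewrite cmulE (reindex_inj (h := fun A => symd A C)) /=; last first.
  by move=> A B /(congr1 (fun D => symd D C)); rewrite -!symdA symdv !symd0.
by apply: eq_bigr => A _; rewrite -!symdA symdv symd0.
Qed.

Lemma gradesM P Q (S : nat -> bool) U V :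
    (forall A B, P #|A| -> Q #|B| -> S #|symd A B|) ->
  grades P U -> grades Q V -> grades S (U ** V).
Proof.
move=> PQS PU QV C; apply: contraNT => nS; rewrite cmulE big1 // => A _.
apply/eqP; apply: contraNT nS; rewrite !mulf_eq0 !negb_or => /andP[/andP[_ /PU PA] /QV].
by move=> QB; have := PQS _ _ PA QB; rewrite symdK.
Qed.

Lemma csign_comm A B : (sgn A B == sgn B A) = ~~ odd (#|A| * #|B| + #|A :&: B|).
Proof.
rewrite csign_swap -signr_odd; case: odd; rewrite ?mul1r ?eqxx // expr1 mulN1r.
by rewrite eq_sym -addr_eq0 -mulr2n mulrn_eq0 /= (negbTE (csign_neq0 norm_eta _ _)).
Qed.

(** Commuting pairs of blades cancel, so only anticommuting pairs, recognised by the odd parity,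
    contribute a grade. *)
Lemma grades_commutator P Q (S : nat -> bool) U V :
    (forall A B, P #|A| -> Q #|B| -> odd (#|A| * #|B| + #|A :&: B|) -> S #|symd A B|) ->
  grades P U -> grades Q V -> grades S (U ** V - V ** U).
Proof.
move=> PQS PU QV C; apply: contraNT => nS.
rewrite clB cmulE cmulE_r -sumrB big1 // => A _.
apply/eqP; apply: contraNT nS => ne0.
have : (sgn A (symd A C) - sgn (symd A C) A) * (U A * V (symd A C)) != 0.
  by apply: contraNN ne0 => /eqP e; apply/eqP; rewrite -e; ring.
rewrite !mulf_eq0 !negb_or subr_eq0 csign_comm negbK => /and3P[od /PU PA /QV QB].
by have := PQS _ _ PA QB od; rewrite symdK.
Qed.

Lemma grades_false U : grades xpred0 U -> U = 0.
Proof.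
move=> U0; apply/ffunP => A; rewrite ffunE; apply/eqP; apply/negP => /negP.
by move/U0.
Qed.

Lemma grades_comm P Q U V :
    (forall A B, P #|A| -> Q #|B| -> ~~ odd (#|A| * #|B| + #|A :&: B|)) ->
  grades P U -> grades Q V -> U ** V = V ** U.
Proof.
move=> PQ PU QV; apply/eqP; rewrite -subr_eq0; apply/eqP/grades_false.
apply: (grades_commutator _ PU QV) => A B PA QB.
by rewrite (negbTE (PQ A B PA QB)).
Qed.

(** Multiplication by a fixed blade permutes the blades up to scalars, so this coordinate sees only
    [U A] and nothing else can cancel it. *)
Lemma commutator_blade U A B :
  (U ** blade K B - blade K B ** U) (symd A B) = (sgn A B - sgn B A) * U A.
Proof.
have b0 D : D != A -> blade K B (symd D (symd A B)) = 0.
  rewrite ffunE => /eqP ne; case: (altP (_ =P B)) => // e; case: ne.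
  by rewrite -[D]symd0 -(symdv (symd A B)) symdA e symdC -symdA symdv symd0.
rewrite clB cmulE (bigD1 A) //= big1 ?addr0; last first.
  by move=> D /b0 ->; rewrite mulr0.
rewrite cmulE_r (bigD1 A) //= big1 ?addr0; last first.
  by move=> D /b0 ->; rewrite mulr0 mul0r.
by rewrite symdK ![blade _ _ _]ffunE eqxx !mulr1 mulrBl.
Qed.

Lemma cardsI1 A i : #|A :&: [set i]%SET| = (i \in A).
Proof.
have -> : A :&: [set i]%SET = if i \in A then [set i]%SET else finset.set0.
  apply/setP => j; rewrite !inE; case: (altP (j =P i)) => [->|/negbTE ne].
    by rewrite andbT; case: ifP; rewrite inE ?eqxx.
  by rewrite andbF; case: ifP; rewrite inE ?ne.
by case: ifP; rewrite ?cards1 ?cards0.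
Qed.

Lemma commutator_vector_grades (S : nat -> bool) U :
    (forall i, grades S (U ** blade K [set i]%SET - blade K [set i]%SET ** U)) ->
  forall A i, U A != 0 -> odd (#|A| + (i \in A)) -> S #|symd A [set i]%SET|.
Proof.
move=> h A i UA od; apply: (h i); rewrite commutator_blade mulf_neq0 // subr_eq0.
by rewrite csign_comm cards1 muln1 cardsI1 negbK.
Qed.

(** If [U A] is nonzero, then |A| + [i in A] is even for every i. For nonempty A this forces |A| odd
    and leaves no index outside A, so A is the full set and n is odd. *)
Lemma vector_commutant_center U :
  (forall i, U ** blade K [set i]%SET = blade K [set i]%SET ** U) -> center U.
Proof.
move=> h A UA.
have odA i : ~~ odd (#|A| + (i \in A)).
  apply/negP => od.
  suff : xpred0 #|symd A [set i]%SET| by [].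
  apply: (@commutator_vector_grades xpred0 U _ A i UA od) => j.
  by rewrite h subrr => B; rewrite ffunE eqxx.
case: (set_0Vmem A) => [->|[i iA]]; first by rewrite cards0.
have := odA i; rewrite iA addn1 /= negbK => odc.
have eA : #|A| == n.
  rewrite card_eqn; apply/eqP/setP => j; rewrite inE; apply/negPn/negP => jA.
  by have := odA j; rewrite (negbTE jA) addn0 odc.
by rewrite eA andbT; move: odc; rewrite (eqP eA) => ->; rewrite orbT.
Qed.

Lemma center_comm W V : center W -> W ** V = V ** W.
Proof.
move=> cW; apply: (@grades_comm _ xpredT) cW _ => // A B.
case/orP => [|/andP[on]]; first by rewrite cards_eq0 => /eqP->; rewrite finset.set0I cards0.
rewrite card_eqn => /eqP-> _.
by rewrite finset.setTI cardsT card_ord oddD oddM on /= addbb.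
Qed.

Lemma zero_top_symd A B :
  (#|A| == 0%N) || (#|A| == n) -> (#|B| == 0%N) || (#|B| == n) ->
  (#|symd A B| == 0%N) || (#|symd A B| == n).
Proof.
rewrite !card_eqn !cards_eq0 => /orP[] /eqP-> /orP[] /eqP->;
  by rewrite ?symdv ?symd0 ?symd0l ?eqxx ?orbT.
Qed.

Lemma zero_top_mul U V :
  grades (fun k => (k == 0) || (k == n))%N U ->
  grades (fun k => (k == 0) || (k == n))%N V ->
  grades (fun k => (k == 0) || (k == n))%N (U ** V).
Proof. by apply: gradesM => A B; exact: zero_top_symd. Qed.

Lemma centerE : center =
  grades (if odd n then (fun k => (k == 0) || (k == n)) else eq_op^~ 0)%N.
Proof. by rewrite /Defs.center; case: odd => //; apply: grades_eq => k _; rewrite orbF. Qed.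

Lemma center_mul U V : center U -> center V -> center (U ** V).
Proof.
rewrite centerE; case: odd; first exact: zero_top_mul.
apply: gradesM => A B; rewrite !cards_eq0 => /eqP-> /eqP->.
by rewrite symd0.
Qed.

Lemma inv_pair_uniq T S S' : inv_pair T S -> inv_pair T S' -> S = S'.
Proof.
by move=> [_ h1] [h2 _]; rewrite -[S](cmul1r eta) -h2 cmulA h1 cmul1l.
Qed.

Lemma inv_pairM T S T' S' : inv_pair T S -> inv_pair T' S' ->
  inv_pair (T ** T') (S' ** S).
Proof.
move=> [a b] [c d]; split.
  by rewrite cmulA -(cmulA eta T) c cmul1r.
by rewrite cmulA -(cmulA eta S') b cmul1r.
Qed.

(** Since [center] is defined by grades, closure under inverses goes through commutation with
    vectors: S v = S v W S = S W v S = v S. *)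
Lemma center_inv W S : center W -> inv_pair W S -> center S.
Proof.
move=> cW [WS SW]; apply: vector_commutant_center => i; set v := blade _ _.
have -> : S ** v = S ** (v ** W) ** S by rewrite -!cmulA WS cmul1r.
by rewrite -(center_comm v cW) cmulA SW cmul1l.
Qed.

(** For T = W T' with T' even or odd, hat(T') = +-T', hence hat(T) T^-1 = +-hat(W) W^-1, a product
    of central elements. *)
Lemma groupP_hat T S : groupP eta T -> inv_pair T S -> center (ghat T ** S).
Proof.
move=> [W [T' [[cW [W' WW']] [hT' ->]]]] [TS _].
have [e hat_T'] : exists e : K, ghat T' = e *: T'.
  case: hT' => -[hT' _]; [exists 1|exists (-1)]; apply/ffunP => A;
  rewrite !ffunE /GRing.scale /=; case: (eqVneq (T' A) 0) => [->|/hT' od];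
  by rewrite ?mulr0 // -signr_odd; move: od; case: odd.
rewrite ghatM hat_T' cmulZr cmulZl; apply: gradesZ.
have -> : ghat W ** T' ** S = ghat W ** W'.
  rewrite -[ghat W ** W'](cmul1r eta) -TS !cmulA -[ghat W ** W' ** W]cmulA.
  by case: WW' => _ ->; rewrite cmul1r.
apply: center_mul; last exact: center_inv WW'.
exact: gradescale_grades.
Qed.

End Grades.

(** * The Lie algebras as sums of grade subspaces *)

Section LieAlgebras.
Variables (R : realType) (K : numFieldType) (emb : {rmorphism R -> K}).
Hypothesis hK : exp_scalars emb.
Variables (n : nat) (eta : 'I_n -> K).
Hypothesis norm_eta : forall i, `|eta i| = 1.
Implicit Types (A B C : {set 'I_n}) (U V X Y : cl K n) (P Q : nat -> bool).

Local Notation "U ** V" := (cmul eta U V) (at level 40, left associativity).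
Local Notation center := (@Defs.center K n).
Local Notation inv_pair := (@Defs.inv_pair K n eta).
Local Notation cexp := (cexp eta).
Local Notation L := (liealg eta emb).
Local Notation zero_top := (fun k => (k == 0) || (k == n))%N.

Lemma grades_one P : P 0%N -> grades P (cone K n).
Proof. by move=> P0; apply/grades_blade; rewrite cards0. Qed.

Lemma cexp_grades P U : P 0%N -> (forall Y, grades P Y -> grades P (U ** Y)) ->
  grades P (cexp U).
Proof.
move=> P0 PU; have -> : cexp U = cexp U ** cone K n ** cexp 0.
  by rewrite cexp0 !cmul1r.
apply: (twoside_exp_grades hK norm_eta) => //; first exact: grades_one.
by move=> Y PY; rewrite /twoside cmul0r addr0; exact: PU.
Qed.

Lemma cexp_inv U : inv_pair (cexp U) (cexp (- U)).
Proof. by split; [exact: (cexpNr hK norm_eta U) | exact: (cexpNl hK norm_eta U)]. Qed.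

Lemma center_one : center (cone K n).
Proof. exact: grades_one. Qed.

Lemma center_cexp U : center U -> center (cexp U).
Proof. by move=> cU; apply: cexp_grades => // Y; exact: center_mul. Qed.

Lemma lieP_grades :
  L (groupP eta) = grades (fun k => ~~ odd k || (odd n && (k == n))).
Proof.
apply/seteqP; split => U hU.
  have : center (twoside eta (ghat U) (- U) (cone K n)).
    apply: (twoside_grades_deriv hK norm_eta center_one) => t.
    rewrite cmul1r scalerN -[emb t *: ghat U]gradescaleZ -(ghat_cexp hK norm_eta).
    exact: (groupP_hat norm_eta (hU t) (cexp_inv _)).
  (* hat(U) - U is -2 times the odd part of U; if it is central, the only odd grade left is n. *)
  rewrite /twoside cmul1r cmul1l => cU A UA; case: (boolP (odd #|A|)) => //= od.
  have : (ghat U - U) A != 0.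
    rewrite clB ffunE -signr_odd od expr1 mulN1r -opprD oppr_eq0 -mulr2n.
    by rewrite mulrn_eq0.
  by move/cU; case: eqP od => // ->.
move=> t.
(* V splits into a central odd part [U1] and an even part [U0]; they commute, so exp(V) = exp(U1)
   exp(U0) is a factorization as [groupP] requires. *)
pose V : cl K n := emb t *: U.
pose U0 : cl K n := [ffun A : {set 'I_n} => if odd #|A| then 0 else V A].
pose U1 : cl K n := [ffun A : {set 'I_n} => if odd #|A| then V A else 0].
have hV : grades (fun k => ~~ odd k || (odd n && (k == n))) V by exact: gradesZ.
have V01 : V = U1 + U0.
  by apply/ffunP => A; rewrite !ffunE; case: odd; rewrite ?addr0 ?add0r.
have c1 : center U1.
  move=> A; rewrite ffunE; case: ifP; rewrite ?eqxx // => od /hV.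
  by rewrite od /= => ->; rewrite orbT.
have e0 : grades (fun k => ~~ odd k) U0.
  by move=> A; rewrite ffunE; case: ifP => // _; rewrite eqxx.
rewrite -/V; exists (cexp U1), (cexp U0); split; [|split].
- split; first exact: center_cexp.
  by exists (cexp (- U1)); exact: cexp_inv.
- left; split; last by exists (cexp (- U0)); exact: cexp_inv.
  apply: cexp_grades => // Y; apply: gradesM e0 => A B eA eB.
  have := card_symd A B; move: eA eB; lia.
- by rewrite (cexpD hK norm_eta (center_comm norm_eta U0 c1)) V01.
Qed.

(** [phi] stands for the reversion or its composite with the grade involution; phi U + U is D
    applied to 1. *)
Lemma lie_anti_sub P (phi : cl K n -> cl K n) U : P 0%N ->
  (forall V, phi (cexp V) = cexp (phi V)) ->
  (forall a V, phi (a *: V) = a *: phi V) ->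
  (forall t, grades P (phi (cexp (emb t *: U)) ** cexp (emb t *: U))) ->
  grades P (phi U + U).
Proof.
move=> P0 phiE phiZ h; rewrite -[phi U](cmul1r eta) -[X in _ + X](cmul1l eta).
apply: (twoside_grades_deriv hK norm_eta (grades_one P0)) => t.
by rewrite cmul1r -phiZ -phiE; exact: h.
Qed.

Lemma lie_anti_sup P (phi : cl K n -> cl K n) U : P 0%N ->
  (forall V, phi (cexp V) = cexp (phi V)) ->
  (forall a V, phi (a *: V) = a *: phi V) ->
  (forall Y, grades P Y -> grades P (phi U ** Y + Y ** U)) ->
  forall t, units_of eta (grades P) (phi (cexp (emb t *: U)) ** cexp (emb t *: U)).
Proof.
move=> P0 phiE phiZ h t; rewrite phiE; split; last first.
  by eexists; apply: inv_pairM; exact: cexp_inv.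
rewrite -[cexp (phi _)](cmul1r eta); apply: (twoside_exp_grades hK norm_eta) => //.
  exact: grades_one.
move=> Y PY; rewrite phiZ /twoside cmulZl cmulZr -scalerDr.
by apply: gradesZ; exact: h.
Qed.

Lemma crevZ a U : crev (a *: U) = a *: crev U.
Proof. by rewrite !crevE gradescaleZ. Qed.

Lemma ghat_crevZ a U : ghat (crev (a *: U)) = a *: ghat (crev U).
Proof. by rewrite !ghat_crevE gradescaleZ. Qed.

Lemma crevexp V : crev (cexp V) = cexp (crev V).
Proof. exact: (crev_cexp hK norm_eta V). Qed.

Lemma ghat_crevexp V : ghat (crev (cexp V)) = cexp (ghat (crev V)).
Proof. by rewrite crevexp; exact: (ghat_cexp hK norm_eta _). Qed.

(** A central Y moves to the left: V Y + Y U = Y (V + U). *)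
Lemma sum_central_stable V U Y : center (V + U) -> center Y ->
  center (V ** Y + Y ** U).
Proof.
move=> cVU cY; rewrite -(center_comm norm_eta V cY) -cmulDr.
exact: center_mul.
Qed.

Lemma lieA_mem U : L (groupA eta) U <-> center (crev U + U).
Proof.
split=> [h|h t].
  by apply: (lie_anti_sub (phi := @crev K n)) crevexp crevZ _ => // t; have [_ []] := h t.
split; first by split=> //; eexists; exact: cexp_inv.
apply: (lie_anti_sup _ crevexp crevZ) => // Y; exact: sum_central_stable.
Qed.

Lemma lieB_mem U : L (groupB eta) U <-> center (ghat (crev U) + U).
Proof.
split=> [h|h t].
  apply: (lie_anti_sub (phi := fun V => ghat (crev V))) ghat_crevexp ghat_crevZ _ => // t.
  by have [_ []] := h t.
split; first by split=> //; eexists; exact: cexp_inv.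
apply: (lie_anti_sup (phi := fun V => ghat (crev V)) _ ghat_crevexp ghat_crevZ) => // Y.
exact: sum_central_stable.
Qed.

(** On grade k the sum is 0 or 2U according to the parity of [s k], so Q restricts only the grades
    with [s k] even. *)
Lemma gradescale_sum_grades (s : nat -> nat) Q U :
  grades Q (gradescale (fun A => (-1) ^+ s #|A|) U + U) <->
  grades (fun k => odd (s k) || Q k) U.
Proof.
have E A : (gradescale (fun A => (-1) ^+ s #|A|) U + U) A =
    if odd (s #|A|) then 0 else U A *+ 2.
  rewrite !ffunE -signr_odd; case: odd; rewrite ?mul1r //.
  by rewrite expr1 mulN1r addNr.
split=> h A.
  move=> UA; case: (boolP (odd _)) => //= nod; apply: h; rewrite E (negbTE nod).
  by rewrite mulrn_eq0.
rewrite E; case: (boolP (odd _)) => [_|nod]; first by rewrite eqxx.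
by rewrite mulrn_eq0 /= => /h; rewrite (negbTE nod).
Qed.

(** C(k, 2) is odd exactly for k = 2, 3 mod 4. The center adds grade n for odd n, which is new only
    when n = 1 mod 4. *)
Lemma lieA_grades : L (groupA eta) =
  grades (fun k => [|| k == 0, k %% 4 == 2, k %% 4 == 3 | (n %% 4 == 1) && (k == n)])%N.
Proof.
transitivity (@grades K n (fun k => odd 'C(k, 2) || ((k == 0) || (odd n && (k == n))))%N).
  apply/seteqP; split => U; rewrite lieA_mem crevE.
    by move/(gradescale_sum_grades (fun k => 'C(k, 2))).
  by move=> h; apply/(gradescale_sum_grades (fun k => 'C(k, 2))).
by apply: grades_eq => k kn; rewrite odd_bin2_mod4; lia.
Qed.

(** Here the exponent k + C(k, 2) is odd exactly for k = 1, 2 mod 4, so the central grade n is new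
    only when n = 3 mod 4. *)
Lemma lieB_grades : L (groupB eta) =
  grades (fun k => [|| k == 0, k %% 4 == 1, k %% 4 == 2 | (n %% 4 == 3) && (k == n)])%N.
Proof.
transitivity (@grades K n (fun k => odd (k + 'C(k, 2)) || ((k == 0) || (odd n && (k == n))))%N).
  apply/seteqP; split => U; rewrite lieB_mem ghat_crevE.
    by move/(gradescale_sum_grades (fun k => k + 'C(k, 2))%N).
  by move=> h; apply/(gradescale_sum_grades (fun k => k + 'C(k, 2))%N).
by apply: grades_eq => k kn; rewrite oddD odd_bin2_mod4; lia.
Qed.

Lemma lieQ_cap : L (groupQ eta) = (L (groupA eta) `&` L (groupP eta))%classic.
Proof.
apply/seteqP; split => U.
  by move=> h; split => t; have [hP hu] := h t => //; split => //; split => //;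
    exists (cexp (- (emb t *: U))); exact: cexp_inv.
by move=> [hA hP] t; split; [exact: hP | have [] := hA t].
Qed.

Lemma grades_cap P Q : (@grades K n P `&` @grades K n Q)%classic =
  grades (fun k => P k && Q k).
Proof.
apply/seteqP; split => U; first by move=> [p q] A UA; rewrite p ?q.
by move=> h; split => A /h /andP[].
Qed.

Lemma lieQ_grades : L (groupQ eta) =
  grades (fun k => [|| k == 0, k %% 4 == 2 | odd n && (k == n)])%N.
Proof.
rewrite lieQ_cap lieA_grades lieP_grades grades_cap.
by apply: grades_eq => k kn; lia.
Qed.

Lemma lieQ'_sub U : L (groupQ' eta) U -> L (groupP eta) U /\
  grades zero_top (crev U + U).
Proof.
move=> h; split; first by move=> t; have [] := h t.
by apply: (lie_anti_sub (phi := @crev K n)) crevexp crevZ _ => // t; have [_ []] := h t.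
Qed.

(** This replaces centrality of C^n when n is even; it suffices because then p consists of even
    elements. *)
Lemma zero_top_comm U Y : ~~ odd n -> grades (fun k => ~~ odd k) U ->
  grades zero_top Y -> Y ** U = U ** Y.
Proof.
move=> en eU zY; apply: (grades_comm norm_eta _ zY eU) => A B.
case/orP; first by rewrite cards_eq0 => /eqP-> _; rewrite finset.set0I cards0.
rewrite card_eqn => /eqP-> eB.
by rewrite finset.setTI cardsT card_ord oddD oddM (negbTE en).
Qed.

Lemma lieQ'_sup U : ~~ odd n -> L (groupP eta) U ->
  grades zero_top (crev U + U) -> L (groupQ' eta) U.
Proof.
move=> en hP hz t; split; first exact: hP.
have eU : grades (fun k => ~~ odd k) U.
  move: hP; rewrite lieP_grades; apply: grades_sub => k _.
  by rewrite (negbTE en) orbF.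
apply: (lie_anti_sup _ crevexp crevZ) => // Y zY.
by rewrite (zero_top_comm en eU zY) -cmulDl; exact: zero_top_mul.
Qed.

Lemma lieQ'_grades : L (groupQ' eta) =
  if (n %% 4 == 0)%N then grades (fun k => [|| k == 0, k %% 4 == 2 | k == n])%N
  else L (groupQ eta).
Proof.
case: ifP => n4.
  have en : ~~ odd n by move: n4; lia.
  transitivity ([set U | grades (fun k => ~~ odd k || (odd n && (k == n))) U /\
     grades (fun k => odd 'C(k, 2) || (k == 0) || (k == n))%N U] : set (cl K n))%classic.
    apply/seteqP; split => U /=.
      move/lieQ'_sub => []; rewrite lieP_grades => hP; rewrite crevE => hz.
      split=> //; have /(gradescale_sum_grades (fun k => 'C(k, 2))) := hz.
      by apply: grades_sub => k _; rewrite orbA.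
    move=> [hP hz]; apply: lieQ'_sup => //; first by rewrite lieP_grades.
    rewrite crevE; apply/(gradescale_sum_grades (fun k => 'C(k, 2))).
    by move: hz; apply: grades_sub => k _; rewrite orbA.
  have -> : ([set U | grades (fun k => ~~ odd k || (odd n && (k == n))) U /\
     grades (fun k => odd 'C(k, 2) || (k == 0) || (k == n))%N U] : set (cl K n))%classic =
    (grades (fun k => ~~ odd k || (odd n && (k == n))) `&`
     @grades K n (fun k => odd 'C(k, 2) || (k == 0) || (k == n))%N)%classic by [].
  by rewrite grades_cap; apply: grades_eq => k kn; rewrite odd_bin2_mod4; lia.
(* Otherwise the top grade adds nothing to q: for n odd it is central, and for n = 2 mod 4 it
   already lies in the residue class 2. *)
apply/seteqP; split => U; last first.
  move=> h t; have [hP [hz hu]] := h t; split => //; split => //.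
  by move: hz; apply: grades_sub => k _; case: (k == 0%N) => //= /andP[].
move/lieQ'_sub => []; rewrite lieP_grades => hP; rewrite crevE => hz.
rewrite lieQ_grades => A UA; have := hP _ UA.
have /(gradescale_sum_grades (fun k => 'C(k, 2))) := hz.
move/(_ _ UA); rewrite odd_bin2_mod4; have := card_ord_le A; lia.
Qed.

Lemma lieG_grades : L (clifford_group eta) =
  grades (fun k => [|| k == 0, k == 2 | odd n && (k == n)])%N.
Proof.
apply/seteqP; split => U hU.
  have h i : grades (eq_op 1%N) (U ** blade K [set i]%SET - blade K [set i]%SET ** U).
    have v1 : grades (eq_op 1%N) (blade K [set i]%SET).
      by apply/grades_blade; rewrite cards1.
    rewrite -cmulNr; apply: (twoside_grades_deriv hK norm_eta v1) => t.
    have [Ti [inv hT]] := hU t.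
    by rewrite scalerN (inv_pair_uniq (cexp_inv (emb t *: U)) inv); exact: hT.
  move=> A UA.
  (* If e_A and e_i anticommute, their commutator has a nonzero coordinate at [symd A [set i]],
     which must have size 1: so |A| is 2 if i is in A and 0 otherwise. *)
  have c i : odd (#|A| + (i \in A)) -> (#|A| == (i \in A).*2)%N.
    move=> od; have := commutator_vector_grades norm_eta h UA od.
    move/eqP => e; have := card_symd A [set i]%SET; rewrite -e cards1 cardsI1.
    by case: (i \in A) => /=; lia.
  case: (set_0Vmem A) => [->|[i iA]]; first by rewrite cards0.
  case: (boolP (odd #|A|)) => od.
    (* An index outside A would force |A| = 0, against |A| odd; so A is full. *)
    suff : #|A| == n by move: od; lia.
    rewrite card_eqn; apply/eqP/setP => j; rewrite inE; apply/negPn/negP => jA.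
    by have := c j; rewrite (negbTE jA) addn0 od => /(_ isT)/eqP e; rewrite e in od.
  by have := c i; rewrite iA addn1 /= od => /(_ isT) ->; rewrite orbT.
move=> t; exists (cexp (- (emb t *: U))); split; first exact: cexp_inv.
move=> X hX; apply: (twoside_exp_grades hK norm_eta) => // Y hY.
rewrite /twoside cmulNr cmulZl cmulZr -scalerBr; apply: gradesZ.
apply: (grades_commutator norm_eta _ hU hY) => A B hA /eqP/esym/eqP/cards1P[b ->].
(* If b is in A, then |A| is even, hence 2, and the product is a vector. If not, |A| is odd, hence
   n, which is impossible. *)
rewrite cards1 muln1 cardsI1; have := card_symd A [set b]%SET.
rewrite cards1 cardsI1; case: (boolP (b \in A)) => bA.
  by move: hA; lia.
have : #|A| != n.
  by rewrite card_eqn; apply: contraNneq bA => ->; rewrite inE.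
by move: hA; lia.
Qed.

End LieAlgebras.

(** * Dimensions of grade subspaces *)

Section GradedDimension.
Variables (K : numFieldType) (n : nat).
Implicit Types (P Q : nat -> bool).

(** The weights are natural numbers, not Booleans, so that a grade condition can be split into a sum
    of indicators. *)
Definition grade_sum (m : nat) (f : nat -> nat) := (\sum_(k < m.+1) f k * 'C(m, k))%N.

Lemma card_grades P : #|[pred A : {set 'I_n} | P #|A|]| = grade_sum n P.
Proof.
rewrite -sum1_card.
transitivity (\sum_(A : {set 'I_n}) \sum_(k < n.+1) ((k == #|A| :> nat) * P k))%N.
  rewrite big_mkcond /=; apply: eq_bigr => A _; rewrite inE.
  have lt : (#|A| < n.+1)%N by rewrite ltnS card_ord_le.
  rewrite (bigD1 (Ordinal lt)) //= eqxx mul1n big1 ?addn0; first by case: (P _).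
  by move=> k ne; rewrite -[X in (_ == X)]/(nat_of_ord (Ordinal lt)) val_eqE (negbTE ne).
rewrite exchange_big; apply: eq_bigr => k _ /=.
rewrite -big_distrl /= mulnC; congr (_ * _)%N.
rewrite -[X in 'C(X, _)]card_ord -card_draws -sum1_card [RHS]big_mkcond /=.
by apply: eq_bigr => A _; rewrite inE eq_sym; case: eqP.
Qed.

Lemma blade_coord0 (A C : {set 'I_n}) (u : cl K n) : u \in <[blade K A]>%VS ->
  C != A -> u C = 0.
Proof.
by move=> /vlineP[a ->] ne; rewrite !ffunE (negbTE ne) /GRing.scale /= mulr0.
Qed.

Lemma grades_vspace P : exists V : {vspace cl K n},
  ([set U | U \in V] = grades P)%classic /\ \dim V = grade_sum n P.
Proof.
exists (\sum_(A : {set 'I_n} | P #|A|) <[blade K A]>)%VS; split.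
  apply/seteqP; split => U /=.
    move=> /memv_sumP[u hu ->] C; apply: contraNT => nP.
    rewrite sum_ffunE big1 // => A PA; apply: (blade_coord0 (hu A PA)).
    by apply: contraNneq nP => ->.
  move=> hU; have -> : U = \sum_(A : {set 'I_n} | P #|A|) U A *: blade K A.
    rewrite {1}(blade_sum U) [RHS]big_mkcond; apply: eq_bigr => A _ /=; case: ifP => // nP.
    have -> : U A = 0 by apply/eqP; apply: contraFT nP => /hU.
    by rewrite scale0r.
  by apply: memv_sumr => A PA; rewrite memvZ // memv_line.
have /directvP/= -> : directv (\sum_(A : {set 'I_n} | P #|A|) <[blade K A]>)%VS.
  apply/directv_sum_independent => u hu u0 A PA; apply/ffunP => C; rewrite ffunE.
  have [->|ne] := eqVneq C A; last exact: (blade_coord0 (hu A PA)).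
  have := congr1 (fun U : cl K n => U A) u0; rewrite sum_ffunE (bigD1 A) //= big1.
    by rewrite addr0 ffunE.
  by move=> B /andP[PB ne]; apply: (blade_coord0 (hu B PB)); rewrite eq_sym.
rewrite -card_grades -sum1_card; apply: eq_bigr => A _.
rewrite dim_vline; case: eqP => // /(congr1 (fun U : cl K n => U A)).
by rewrite !ffunE eqxx => /eqP; rewrite oner_eq0.
Qed.

Lemma grades_neq P Q k : (k <= n)%N -> P k != Q k -> @grades K n P <> @grades K n Q.
Proof.
move=> kn ne e.
have /card_gt0P[A] : (0 < #|[set A : {set 'I_n} | #|A| == k]%SET|)%N.
  by rewrite card_draws card_ord bin_gt0.
rewrite inE => /eqP cA.
have := grades_blade K P A; have := grades_blade K Q A; rewrite e cA => h1 h2.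
by case/negP: ne; apply/eqP; apply/idP/idP => ?; [apply/h1/h2 | apply/h2/h1].
Qed.

End GradedDimension.

(** * Binomial sums over residue classes modulo 4 *)

Section GradeSums.
Implicit Types (f g : nat -> nat).
Local Open Scope nat_scope.

Lemma grade_sumD m f g : grade_sum m (fun k => f k + g k) = grade_sum m f + grade_sum m g.
Proof. by rewrite -big_split; apply: eq_bigr => k _; rewrite mulnDl. Qed.

Lemma eq_grade_sum m f g : (forall k, k <= m -> f k = g k) ->
  grade_sum m f = grade_sum m g.
Proof. by move=> fg; apply: eq_bigr => k _; rewrite fg // -ltnS. Qed.

Lemma grade_sum_pascal m f :
  grade_sum m.+1 f = grade_sum m f + grade_sum m (fun k => f k.+1).
Proof.
rewrite /grade_sum big_ord_recl bin0.
have -> : \sum_(i < m.+1) f (lift ord0 i) * 'C(m.+1, lift ord0 i) =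
  \sum_(i < m.+1) f i.+1 * 'C(m, i.+1) + \sum_(i < m.+1) f i.+1 * 'C(m, i).
  by rewrite -big_split; apply: eq_bigr => i _; rewrite lift0 binS mulnDr.
rewrite addnA; congr (_ + _).
rewrite [RHS]big_ord_recl bin0; congr (_ + _).
rewrite big_ord_recr /= bin_small // muln0 addn0.
by apply: eq_bigr.
Qed.

Lemma grade_sum_zero m : grade_sum m (eq_op^~ 0) = 1.
Proof.
by rewrite /grade_sum big_ord_recl bin0 big1 // => i _; rewrite lift0.
Qed.

Lemma grade_sum_top m b : grade_sum m (fun k => b && (k == m)) = b.
Proof.
rewrite /grade_sum big_ord_recr /= eqxx andbT binn muln1 big1 // => i _.
by rewrite (ltn_eqF (ltn_ord i)) andbF.
Qed.

Definition grade_mod4 m r := grade_sum m (fun k => k %% 4 == r).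

(** Pascal's rule adds to each class the class one below it; this is multiplication by 1 + i when
    the powers i^k are sorted by k mod 4. *)
Lemma grade_mod4S m : [/\ grade_mod4 m.+1 0 = grade_mod4 m 0 + grade_mod4 m 3,
  grade_mod4 m.+1 1 = grade_mod4 m 1 + grade_mod4 m 0,
  grade_mod4 m.+1 2 = grade_mod4 m 2 + grade_mod4 m 1 &
  grade_mod4 m.+1 3 = grade_mod4 m 3 + grade_mod4 m 2].
Proof.
by rewrite /grade_mod4 !grade_sum_pascal; split; congr (_ + _);
  apply: eq_grade_sum => k _; lia.
Qed.

Lemma grade_mod4_total m :
  grade_mod4 m 0 + grade_mod4 m 1 + grade_mod4 m 2 + grade_mod4 m 3 = 2 ^ m.
Proof.
elim: m => [|m IH]; last by case: (grade_mod4S m); rewrite expnS; lia.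
by rewrite /grade_mod4 /grade_sum !big_ord1.
Qed.

Lemma grade_mod4_parity m : grade_mod4 m.+1 0 + grade_mod4 m.+1 2 = 2 ^ m /\
  grade_mod4 m.+1 1 + grade_mod4 m.+1 3 = 2 ^ m.
Proof. by case: (grade_mod4S m); have := grade_mod4_total m; lia. Qed.

End GradeSums.

(** * Trigonometric form of the binomial sums *)

Section Trigonometry.
Variable R : realType.

Lemma cos_sin_pi4 : cos (pi / 4) = sin (pi / 4) :> R.
Proof.
have -> : sin (pi / 4) = sin (pi / 2 - pi / 4) :> R by congr sin; field.
by rewrite sinB cos_pihalf sin_pihalf mul1r mul0r subr0.
Qed.

Lemma sqrt2_cos_pi4 : 2 `^ (2^-1) * cos (pi / 4) = 1 :> R.
Proof.
have p0 := pi_gt0 R.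
have s0 : 0 < 2 `^ (2^-1) * cos (pi / 4) :> R.
  rewrite mulr_gt0 ?powR_gt0 ?ltr0n // cos_gt0_pihalf //.
  by apply/andP; split; lra.
have : (2 `^ (2^-1) * cos (pi / 4)) ^+ 2 = 1 :> R.
  rewrite exprMn -powR_mulrn ?powR_ge0 // -powRrM mulVf ?pnatr_eq0 //.
  rewrite powRr1 ?ler0n //; have := cos2Dsin2 (pi / 4 : R).
  by rewrite -cos_sin_pi4; lra.
by move=> /eqP; rewrite sqrf_eq1 => /orP[/eqP//|/eqP]; lra.
Qed.

Definition rot_cos (m : nat) : R := 2 `^ (m%:R / 2) * cos (pi * m%:R / 4).
Definition rot_sin (m : nat) : R := 2 `^ (m%:R / 2) * sin (pi * m%:R / 4).

(** One step multiplies by 1 + i, of modulus 2^(1/2) and argument pi / 4. *)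
Lemma rotS m : rot_cos m.+1 = rot_cos m - rot_sin m /\
  rot_sin m.+1 = rot_cos m + rot_sin m.
Proof.
rewrite /rot_cos /rot_sin.
have -> : pi * m.+1%:R / 4 = pi * m%:R / 4 + pi / 4 :> R.
  by rewrite -natr1; field.
have -> : 2 `^ (m.+1%:R / 2) = 2 `^ (m%:R / 2) * 2 `^ (2^-1) :> R.
  by rewrite -powRD ?pnatr_eq0 ?implybT // -natr1; congr (_ `^ _); field.
rewrite cosD sinD -cos_sin_pi4; have := sqrt2_cos_pi4.
move: (2 `^ (m%:R / 2)) (2 `^ 2^-1) (cos (pi / 4)) => a s c sc.
move: (cos _) (sin _) => x y; split.
  by rewrite -[RHS]mulr1 -sc; ring.
by rewrite -[RHS]mulr1 -sc; ring.
Qed.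

(* Real and imaginary part of [(1 + i)^m]. *)
Lemma rot_grade_mod4 m :
  rot_cos m = (grade_mod4 m 0)%:R - (grade_mod4 m 2)%:R /\
  rot_sin m = (grade_mod4 m 1)%:R - (grade_mod4 m 3)%:R.
Proof.
elim: m => [|m [IHc IHs]].
  rewrite /rot_cos /rot_sin mul0r mulr0 mul0r cos0 sin0 powRr0.
  by rewrite /grade_mod4 /grade_sum !big_ord1 /= !bin0 !mulr1 !mulr0 subr0 subrr.
case: (rotS m) (grade_mod4S m) => -> -> [-> -> -> ->].
by rewrite IHc IHs !natrD; split; ring.
Qed.

(** The left side is half the imaginary part of (1 + i)^(m+1), because (m + 1) / 2 = (m - 1) / 2 +
    1; [rotS] brings it back to m. *)
Lemma half_rot_sin m : 2 `^ ((m%:R - 1) / 2) * sin (pi * (m%:R + 1) / 4) =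
  ((grade_mod4 m 0)%:R - (grade_mod4 m 2)%:R
   + ((grade_mod4 m 1)%:R - (grade_mod4 m 3)%:R)) / 2 :> R.
Proof.
case: (rot_grade_mod4 m) => <- <-; case: (rotS m) => _ <-; rewrite /rot_sin natr1.
have -> : m.+1%:R / 2 = (m%:R - 1) / 2 + 1 :> R by rewrite -natr1; field.
by rewrite powRD ?pnatr_eq0 ?implybT // powRr1 ?ler0n //; field.
Qed.

Lemma half_rot_cos m : 2 `^ ((m%:R - 1) / 2) * cos (pi * (m%:R + 1) / 4) =
  ((grade_mod4 m 0)%:R - (grade_mod4 m 2)%:R
   - ((grade_mod4 m 1)%:R - (grade_mod4 m 3)%:R)) / 2 :> R.
Proof.
case: (rot_grade_mod4 m) => <- <-; case: (rotS m) => <- _; rewrite /rot_cos natr1.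
have -> : m.+1%:R / 2 = (m%:R - 1) / 2 + 1 :> R by rewrite -natr1; field.
by rewrite powRD ?pnatr_eq0 ?implybT // powRr1 ?ler0n //; field.
Qed.

Lemma quarter_rot_cos m : 2 `^ ((m%:R - 2) / 2) * cos (pi * m%:R / 4) =
  ((grade_mod4 m 0)%:R - (grade_mod4 m 2)%:R) / 2 :> R.
Proof.
case: (rot_grade_mod4 m) => <- _; rewrite /rot_cos.
have -> : m%:R / 2 = (m%:R - 2) / 2 + 1 :> R by field.
by rewrite powRD ?pnatr_eq0 ?implybT // powRr1 ?ler0n //; field.
Qed.

End Trigonometry.

(** * All claims, for scalars satisfying [exp_scalars] *)

Section Claims.
Variables (R : realType) (K : numFieldType) (emb : {rmorphism R -> K}).
Hypothesis hK : exp_scalars emb.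
Variables (n : nat) (eta : 'I_n -> K).
Hypothesis norm_eta : forall i, `|eta i| = 1.
Hypothesis n_ge2 : (2 <= n)%N.

Lemma lie_claims_exp_scalars : lie_claims eta (emb : R -> K).
Proof.
have [par0 par1] := grade_mod4_parity n.-1.
have nE1 : n.-1.+1 = n by lia.
rewrite nE1 in par0 par1.
rewrite /lie_claims; cbv zeta.
rewrite (lieQ'_grades hK norm_eta) (lieP_grades hK norm_eta) (lieA_grades hK norm_eta).
rewrite (lieB_grades hK norm_eta) (lieQ_grades hK norm_eta) (lieG_grades hK norm_eta).
split; [by split | split; split].
- have [V [eV dV]] := grades_vspace K n (fun k => ~~ odd k || (odd n && (k == n))).
  exists V; split => //; rewrite dV -par0 -(grade_sum_top n (odd n)) -!grade_sumD.
  by apply: eq_grade_sum => k kn; lia.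
- set P := (X in grades X); have [V [eV dV]] := grades_vspace K n P.
  exists V; split => //; rewrite dV half_rot_sin.
  have -> : grade_sum n P = (grade_mod4 n 2 + grade_mod4 n 3 + 1 + (n %% 4 == 1))%N.
    rewrite -[X in (_ + X + _)%N](grade_sum_zero n) -(grade_sum_top n (n %% 4 == 1)%N) -!grade_sumD.
    by apply: eq_grade_sum => k kn; rewrite /P /=; lia.
  (* The even and the odd grades both total 2^(n-1), so twice the classes 2 and 3 equals 2 * 2^(n-1)
     minus the numerator given by [half_rot_sin]. *)
  rewrite !natrD -par0 natrD.
  have : (grade_mod4 n 0)%:R + (grade_mod4 n 2)%:R =
         (grade_mod4 n 1)%:R + (grade_mod4 n 3)%:R :> R by rewrite -!natrD par0 par1.
  by lra.
- set P := (X in grades X); have [V [eV dV]] := grades_vspace K n P.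
  exists V; split => //; rewrite dV half_rot_cos.
  have -> : grade_sum n P = (grade_mod4 n 1 + grade_mod4 n 2 + 1 + (n %% 4 == 3))%N.
    rewrite -[X in (_ + X + _)%N](grade_sum_zero n) -(grade_sum_top n (n %% 4 == 3)%N) -!grade_sumD.
    by apply: eq_grade_sum => k kn; rewrite /P /=; lia.
  rewrite !natrD -par0 natrD.
  have : (grade_mod4 n 0)%:R + (grade_mod4 n 2)%:R =
         (grade_mod4 n 1)%:R + (grade_mod4 n 3)%:R :> R by rewrite -!natrD par0 par1.
  by lra.
- set P := (X in grades X); have [V [eV dV]] := grades_vspace K n P.
  exists V; split => //; rewrite dV quarter_rot_cos.
  have -> : grade_sum n P = (grade_mod4 n 2 + 1 + odd n)%N.
    rewrite -[X in (_ + X + _)%N](grade_sum_zero n) -(grade_sum_top n (odd n)) -!grade_sumD.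
    by apply: eq_grade_sum => k kn; rewrite /P /=; lia.
  have : (2 ^ n.-1)%:R = (2 ^ n.-2)%:R * 2 :> R.
    by rewrite -natrM mulnC -expnS; congr (_ ^ _)%:R; lia.
  by rewrite !natrD -par0 natrD; lra.
- move=> n4; rewrite n4.
  pose f k := [|| k == 0, k %% 4 == 2 | odd n && (k == n)]%N.
  have [V [eV dV]] := grades_vspace K n f.
  have [V' [eV' dV']] := grades_vspace K n (fun k => [|| k == 0, k %% 4 == 2 | k == n])%N.
  exists V, V'; split => //; split => //; rewrite dV dV'.
  (* For n > 0 divisible by 4, the grade n is not counted by [f]. *)
  apply: (@etrans _ _ (grade_sum n f + grade_sum n (fun k => true && (k == n)))%N).
    by rewrite -grade_sumD; apply: eq_grade_sum => k kn; rewrite /f; lia.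
  by rewrite grade_sum_top addn1.
- do 4?[split; first by apply: grades_sub => k kn; lia].
  by rewrite !grades_cap; split; [|split]; apply: grades_eq => k kn; lia.
- by move=> n3; split; apply: grades_eq => k kn; lia.
- move=> n4; split; [|split].
  (* For n = 4 the grades are 0, 2 in q, then 0, 2, 4 in p and 0, 2, 3 in a; a blade of grade 4 or 3
     separates them. *)
  + by apply: (@grades_neq _ _ _ _ 4); lia.
  + by apply: (@grades_neq _ _ _ _ 3); lia.
  + by apply: (@grades_neq _ _ _ _ 3); lia.
- split=> [n5|n6]; first by apply: grades_eq => k kn; lia.
  by apply: (@grades_neq _ _ _ _ 6); lia.
- move=> n4; rewrite n4.
  do 3?[split; first by apply: grades_sub => k kn; lia].
  split; first by apply: (@grades_neq _ _ _ _ n); lia.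
  split=> [e|n8]; first by apply: grades_eq => k kn; lia.
  by apply: (@grades_neq _ _ _ _ 4); lia.
Qed.

End Claims.

(** * Real and complex scalars *)

Section Instances.
Variable R : realType.

Lemma cvg_exp_dominated (a : nat -> R) (c M : R) :
  (forall k, `|a k| <= c * (M ^+ k / (k`!)%:R)) ->
  cvgn (fun m => \sum_(k < m) a k : R^o).
Proof.
move=> h.
have -> : (fun m => \sum_(k < m) a k : R^o) = series a.
  by apply/funext => m; rewrite /series /= big_mkord.
apply: (@normed_cvg R R^o); rewrite /=.
apply: (@series_le_cvg _ _ (fun k => c * (M ^+ k / (k`!)%:R))) => //.
- by move=> k; exact: normr_ge0.
- by move=> k; exact: (le_trans (normr_ge0 _) (h k)).
have -> : (fun k => c * (M ^+ k / (k`!)%:R)) = (c \*: exp_coeff M : R ^nat) by [].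
by apply: is_cvg_seriesZ; exact: is_cvg_series_exp_coeff.
Qed.

Lemma exp_scalars_real : exp_scalars (idfun : {rmorphism R -> R}).
Proof.
split=> //; first by move=> x; exists `|x|.
by move=> a c M; exact: cvg_exp_dominated.
Qed.

Lemma normc_real (x : R) : `|x%:C%C| = `|x|%:C%C.
Proof. by rewrite normc_def /= expr0n addr0 sqrtr_sqr. Qed.

Lemma lec_real (x y : R) : (x%:C%C <= y%:C%C) = (x <= y).
Proof. by rewrite lecE /= eqxx. Qed.

Lemma ltc_real (x y : R) : (x%:C%C < y%:C%C) = (x < y).
Proof. by rewrite ltcE /= eqxx. Qed.

Lemma normc_le_ReIm (z : R[i]) : `|z| <= (`|complex.Re z| + `|complex.Im z|)%:C%C.
Proof.
rewrite [z in `|z|]complexE; apply: (le_trans (ler_normD _ _)).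
have i1 : `|'i%C : R[i]| = 1 by rewrite normc_def /= expr0n add0r expr1n sqrtr1.
by rewrite normrM i1 mul1r !normc_real rmorphD.
Qed.

Lemma normc_ge_Im (z : R[i]) : `|complex.Im z|%:C%C <= `|z|.
Proof.
rewrite normc_def lec_real -sqrtr_sqr; apply: ler_wsqrtr.
by rewrite lerDr sqr_ge0.
Qed.

(** Real and imaginary parts are dominated by the modulus, so each of the two real series converges;
    the modulus of the error is at most the sum of both errors. *)
Lemma exp_scalars_complex : exp_scalars (real_complex R : {rmorphism R -> R[i]}).
Proof.
split.
- exact: normc_real.
- by move=> x; rewrite normc_def; eexists; exact: lexx.
move=> a c M h.
have /cvg_ex[/= x hx] := @cvg_exp_dominated (fun k => complex.Re (a k)) c M
  (fun k => etrans (esym (lec_real _ _)) (le_trans (normc_ge_Re _) (h k))).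
have /cvg_ex[/= y hy] := @cvg_exp_dominated (fun k => complex.Im (a k)) c M
  (fun k => etrans (esym (lec_real _ _)) (le_trans (normc_ge_Im _) (h k))).
apply/cvg_ex; exists (x +i* y)%C; apply/cvgrPdist_lt => e e0.
(* In the order of [R[i]], a positive e is real. *)
have eE : e = (complex.Re e)%:C%C.
  by move: e0; rewrite ltcE /= => /andP[/eqP im _]; case: e im => u v /= ->.
have re0 : 0 < complex.Re e by move: e0; rewrite ltcE => /andP[].
have e2 : 0 < complex.Re e / 2 by lra.
move/cvgrPdist_lt/(_ _ e2): hx => hx; move/cvgrPdist_lt/(_ _ e2): hy => hy.
apply: filterS2 hx hy => m hx hy.
rewrite eE; apply: (le_lt_trans (normc_le_ReIm _)); rewrite ltc_real.
have -> : complex.Re ((x +i* y)%C - \sum_(k < m) a k) = x - \sum_(k < m) complex.Re (a k).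
  by rewrite raddfB /= raddf_sum.
have -> : complex.Im ((x +i* y)%C - \sum_(k < m) a k) = y - \sum_(k < m) complex.Im (a k).
  by rewrite raddfB /= raddf_sum.
by rewrite [complex.Re e]splitr ltrD.
Qed.

End Instances.

Local Open Scope complex_scope.

(* Real case: Cl_{p,q} over R with eta = diag(+1 (p times), -1 (q times));
   complex case: Cl(C^n) over R[i] with eta = I_n.  In both cases n >= 2. *)
Theorem mainTheorem18 (R : realType) :
  (forall p q : nat, (2 <= p + q)%N ->
     lie_claims (K := R) (n := p + q)
       (fun i : 'I_(p + q) => if (i < p)%N then 1 else -1) (fun t : R => t))
  /\
  (forall n : nat, (2 <= n)%N ->
     lie_claims (K := R[i]) (n := n) (fun _ : 'I_n => 1)
       (fun t : R => t%:C)).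
Proof.
split=> [p q|n] n2.
  apply: (lie_claims_exp_scalars (@exp_scalars_real R)) n2 => i.
  by case: ifP; rewrite ?normrN1 ?normr1.
by apply: (lie_claims_exp_scalars (@exp_scalars_complex R)) n2 => i; rewrite normr1.
Qed.
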